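(* Let $(Y_n)_{n\ge1}$ be i.i.d. nondegenerate with $\mathbb{E}[Y_1]=0$. Let $(\tilde c_k)_{k\ge0}$ be a real sequence with $\sum_{k=1}^\infty k|\tilde c_k|<\infty$ and $\sum_{k=0}^\infty\tilde c_k\ne0$. Let $\tilde X_n:=\sum_{k=1}^n\tilde c_{n-k}Y_k$ and $X_n:=\sum_{k=1}^n\tilde X_k$. (1) If $|Y_1|\le M<\infty$ a.s., there is $x_0\ge0$ such that for all $x\ge x_0$, $\mathbb{P}(\sup_{n=1,\dots,N}X_n\le x)\asymp N^{-1/2}$ as $N\to\infty$. (2) If $\mathbb{E}[\exp(|Y_1|^\alpha)]<\infty$ for some $\alpha>0$, then for all $x\ge0$, $\mathbb{P}(\sup_{n=1,\dots,N}X_n\le x)\precsim N^{-1/2}(\log N)^{1/\alpha}$ as $N\to\infty$. (3) If $\mathbb{E}[\exp(|Y_1|^\alpha)]<\infty$ for some $\alpha>0$ and $\sum_{k=0}^n\tilde c_k\ge0$ for all $n\ge0$, then for all $x\ge0$, $\mathbb{P}(\sup_{n=1,\dots,N}X_n\le x)\succsim N^{-1/2}(\log N)^{-1/\alpha+o(1)}$ as $N\to\infty$.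
   Context: $f\precsim g$ means $\limsup_{N\to\infty} f(N)/g(N)<\infty$; $f\succsim g$ means $g\precsim f$; $f\asymp g$ means both. *)

(* Defs.v *)
From HB Require Import structures.
From mathcomp Require Import all_boot all_order all_algebra.
From mathcomp Require Import all_classical all_reals all_analysis.
Set Implicit Arguments. Unset Strict Implicit. Unset Printing Implicit Defensive.
Import Order.TTheory GRing.Theory Num.Theory.
Import numFieldNormedType.Exports.
Local Open Scope classical_set_scope.
Local Open Scope ring_scope.

Definition iid_indep {d} {T : measurableType d} {R : realType}
  (P : probability T R) (Y : nat -> T -> R) : Prop :=
  forall (s : seq nat) (B : nat -> set R),
    uniq s -> all (fun i => (0 < i)%N) s -> (forall i, measurable (B i)) ->
    P (\bigcap_(i in [set` s]) (Y i @^-1` B i)) =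
    (\prod_(i <- s) P (Y i @^-1` B i))%E.

Definition ident_distr {d} {T : measurableType d} {R : realType}
  (P : probability T R) (Y : nat -> T -> R) : Prop :=
  forall (n : nat) (B : set R), (0 < n)%N -> measurable B ->
    P (Y n @^-1` B) = P (Y 1%N @^-1` B).

Definition nondegenerate_rv {d} {T : measurableType d} {R : realType}
  (P : probability T R) (Z : T -> R) : Prop :=
  forall c : R, (P [set t | Z t = c] < 1)%E.

Definition Xtilde {T} {R : realType} (c : nat -> R) (Y : nat -> T -> R)
  (n : nat) (t : T) : R :=
  \sum_(1 <= k < n.+1) c (n - k)%N * Y k t.

Definition Xsum {T} {R : realType} (c : nat -> R) (Y : nat -> T -> R)
  (n : nat) (t : T) : R :=
  \sum_(1 <= k < n.+1) Xtilde c Y k t.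

Definition prob_sup_le {d} {T : measurableType d} {R : realType}
  (P : probability T R) (c : nat -> R) (Y : nat -> T -> R) (x : R)
  (N : nat) : R :=
  fine (P [set t | forall n : nat, (1 <= n <= N)%N -> Xsum c Y n t <= x]).

(** f ≾ g : limsup_{N->oo} f(N)/g(N) < oo; for g eventually positive
    (the only case used) this is: exists C, eventually f N <= C * g N. *)
Definition precsim {R : realType} (f g : nat -> R) : Prop :=
  exists C : R, \forall N \near \oo, f N <= C * g N.

Definition asymp {R : realType} (f g : nat -> R) : Prop :=
  precsim f g /\ precsim g f.

(* Main.v *)
Require Import Defs.
From HB Require Import structures.
From mathcomp Require Import all_boot all_order all_algebra.
From mathcomp Require Import all_classical all_reals all_analysis.
From mathcomp Require Import measurable_realfun.
From mathcomp Require Import ring lra.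
Import Order.TTheory GRing.Theory Num.Theory.
Import numFieldNormedType.Exports.
Local Open Scope classical_set_scope.
Local Open Scope ring_scope.
Set Implicit Arguments. Unset Strict Implicit. Unset Printing Implicit Defensive.

(** After replacing Y by S Y and c by c / S, where S is the sum of the c_k, we have
    X_n = sum_k C_(n-k) Y_k with C_j -> 1 and sum_j |C_j - 1| <= D, so that X_n
    differs from the random walk S_n by at most D max_(k <= n) |Y_k|.

    Let T be the first time the walk exceeds a level b >= 0. Optional stopping gives
    E[-S_N; T > N] = E[S_T; T <= N]. The right-hand side is at most b plus the
    expected overshoot; by the Harris inequality the left-hand side is at least
    E[S_N^-] P(T > N) - b P(T > N), and E[S_N^-] >= c sqrt N by a fourth moment
    argument. Hence P(T > N) <= C (b + overshoot) / sqrt N. Conversely, by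
    Cauchy-Schwarz, E[-S_N; T > N]^2 <= E[S_(T /\ N)^2] P(T > N), and
    E[S_(T /\ N)^2] = Var(Y_1) E[T /\ N] is controlled by the upper bound, whence
    P(T > N) >= c b / sqrt N for b above the typical overshoot.

    If all C_j are nonnegative, the events {X_n <= x} are decreasing in the Y_k, and
    Harris yields p(N) >= c N^(-1/2) p(m) for p(N) = P(max_(n <= N) X_n <= x) and
    m of order (log N)^(2/alpha); three iterations give the lower bound.

    All of this is carried out for laws with finite support, which approximate the
    law of Y_1 by rounding on a fine grid; the estimates are uniform in the law. *)

(** * Finite laws and the Harris inequality *)

Record finlaw (R : realType) := FinLaw {
  fl_type : finType;
  fl_w : fl_type -> R;
  fl_z : fl_type -> R;
  fl_w_ge0 : forall v, 0 <= fl_w v;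
  fl_w_sum1 : \sum_v fl_w v = 1
}.
Arguments fl_w {R} f v.
Arguments fl_z {R} f v.

Section FiniteExpectation.
Variables (R : realType) (L : finlaw R).
Implicit Types (g : R -> R) (f : seq R -> R) (A B : seq R -> bool).

Definition E1 g : R := \sum_v fl_w L v * g (fl_z L v).

Fixpoint Ex n f : R :=
  if n is n'.+1 then E1 (fun y => Ex n' (fun s => f (y :: s))) else f [::].

Definition Pr n A : R := Ex n (fun s => (A s)%:R).

Lemma E1_le g1 g2 : (forall y, g1 y <= g2 y) -> E1 g1 <= E1 g2.
Proof. by move=> h; apply: ler_sum => v _; rewrite ler_wpM2l// fl_w_ge0. Qed.

Lemma eq_E1 g1 g2 : (forall y, g1 y = g2 y) -> E1 g1 = E1 g2.
Proof. by move=> h; apply: eq_bigr => v _; rewrite h. Qed.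

Lemma E1_cst k : E1 (fun=> k) = k.
Proof. by rewrite /E1 -mulr_suml fl_w_sum1 mul1r. Qed.

Lemma E1D g1 g2 : E1 (fun y => g1 y + g2 y) = E1 g1 + E1 g2.
Proof. by rewrite /E1 -big_split/=; apply: eq_bigr => v _; rewrite mulrDr. Qed.

Lemma E1Z k g : E1 (fun y => k * g y) = k * E1 g.
Proof. by rewrite /E1 mulr_sumr; apply: eq_bigr => v _; rewrite mulrCA. Qed.

Lemma E1_sum (I : Type) (r : seq I) (F : I -> R -> R) :
  E1 (fun y => \sum_(i <- r) F i y) = \sum_(i <- r) E1 (F i).
Proof.
elim: r => [|i r IH].
  by rewrite big_nil (eq_E1 (g2 := fun=> 0)) ?E1_cst// => y; rewrite big_nil.
rewrite big_cons -IH -E1D; apply: eq_E1 => y; exact: big_cons.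
Qed.

Lemma Ex_le n f1 f2 : (forall s, size s = n -> f1 s <= f2 s) ->
  Ex n f1 <= Ex n f2.
Proof.
elim: n f1 f2 => [|n IH] f1 f2 h /=; first exact: h.
by apply: E1_le => y; apply: IH => s hs; apply: h; rewrite /= hs.
Qed.

Lemma eq_Ex n f1 f2 : (forall s, size s = n -> f1 s = f2 s) ->
  Ex n f1 = Ex n f2.
Proof. by move=> h; apply/le_anti/andP; split; apply: Ex_le => s /h ->. Qed.

Lemma Ex_cst n k : Ex n (fun=> k) = k.
Proof. by elim: n => //= n IH; rewrite IH E1_cst. Qed.

Lemma ExD n f1 f2 : Ex n (fun s => f1 s + f2 s) = Ex n f1 + Ex n f2.
Proof.
elim: n f1 f2 => [|n IH] f1 f2 //=; rewrite -E1D; apply: eq_E1 => y; exact: IH.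
Qed.

Lemma ExZ n k f : Ex n (fun s => k * f s) = k * Ex n f.
Proof.
elim: n f => [|n IH] f //=; rewrite -E1Z; apply: eq_E1 => y; exact: IH.
Qed.

Lemma ExN n f : Ex n (fun s => - f s) = - Ex n f.
Proof. by rewrite -mulN1r -ExZ; apply: eq_Ex => s _; rewrite mulN1r. Qed.

Lemma ExB n f1 f2 : Ex n (fun s => f1 s - f2 s) = Ex n f1 - Ex n f2.
Proof. by rewrite ExD ExN. Qed.

Lemma Ex_ge0 n f : (forall s, size s = n -> 0 <= f s) -> 0 <= Ex n f.
Proof. by move=> h; rewrite -[leLHS](Ex_cst n); exact: Ex_le. Qed.

Lemma Pr_ge0 n A : 0 <= Pr n A.
Proof. exact: Ex_ge0. Qed.

Lemma Pr_le1 n A : Pr n A <= 1.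
Proof. by rewrite -[leRHS](Ex_cst n); apply: Ex_le => s _; case: (A s). Qed.

Lemma Pr_sub n A B : (forall s, size s = n -> A s -> B s) -> Pr n A <= Pr n B.
Proof.
move=> h; apply: Ex_le => s /h; case: (A s); last by rewrite ler0n.
by move=> ->.
Qed.

Lemma Pr_le_add n A B C : (forall s, size s = n -> A s -> B s || C s) ->
  Pr n A <= Pr n B + Pr n C.
Proof.
move=> h; rewrite -ExD; apply: Ex_le => s /h.
case: (A s) => [|_]; last by rewrite addr_ge0.
by move=> /(_ isT); case: (B s); case: (C s) => //= _; rewrite ?addr0 ?add0r ?lerDl.
Qed.

Lemma PrC n A : Pr n (fun s => ~~ A s) = 1 - Pr n A.
Proof.
have <- : Ex n (fun=> 1) = 1 by exact: Ex_cst.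
by rewrite /Pr -ExB; apply: eq_Ex => s _; case: (A s) => /=; rewrite ?subrr ?subr0.
Qed.

Lemma Ex_take m n f : Ex (m + n) (fun s => f (take m s)) = Ex m f.
Proof.
elim: m f => [|m IH] f /=.
  by under eq_Ex => s _ do rewrite take0; rewrite Ex_cst.
by apply: eq_E1 => y; rewrite -IH.
Qed.

Lemma Ex_drop m n f : Ex (m + n) (fun s => f (drop m s)) = Ex n f.
Proof.
elim: m f => [|m IH] f /=; first by under eq_Ex => s _ do rewrite drop0.
by rewrite (eq_E1 (g2 := fun=> Ex n f)) ?E1_cst.
Qed.

Lemma Ex_sum n g : Ex n (fun s => \sum_(y <- s) g y) = n%:R * E1 g.
Proof.
elim: n => [|n IH] /=; first by rewrite big_nil mul0r.
transitivity (E1 (fun y => g y + n%:R * E1 g)).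
  apply: eq_E1 => y; rewrite -IH -[g y in RHS](Ex_cst n) -ExD.
  by apply: eq_Ex => s _; rewrite big_cons.
by rewrite E1D E1_cst -natr1; ring.
Qed.

Lemma Pr_has n (a : pred R) : Pr n (has a) <= n%:R * E1 (fun y => (a y)%:R).
Proof.
rewrite -Ex_sum; apply: Ex_le => s _; elim: s => [|y s IH] /=.
  by rewrite big_nil.
rewrite big_cons; case: (a y) => /=.
  by rewrite lerDl sumr_ge0.
by rewrite add0r.
Qed.

Definition antitone f := forall s t, size s = size t ->
  (forall i, s`_i <= t`_i) -> f t <= f s.

Lemma E1_chebyshev g1 g2 : {homo g1 : x y / x <= y >-> y <= x} ->
  {homo g2 : x y / x <= y >-> y <= x} ->
  E1 g1 * E1 g2 <= E1 (fun y => g1 y * g2 y).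
Proof.
move=> h1 h2; have key x y : 0 <= (g1 x - g1 y) * (g2 x - g2 y).
  have [/[dup]/h1 a /h2 b|/ltW/[dup]/h1 a /h2 b] := leP x y.
    by rewrite mulr_ge0 ?subr_ge0.
  by rewrite mulr_le0 ?subr_le0.
have : 0 <= E1 (fun x => E1 (fun y => (g1 x - g1 y) * (g2 x - g2 y))).
  rewrite -[leLHS]E1_cst; apply: E1_le => x; rewrite -[leLHS]E1_cst.
  by apply: E1_le.
suff -> : E1 (fun x => E1 (fun y => (g1 x - g1 y) * (g2 x - g2 y))) =
    2 * (E1 (fun y => g1 y * g2 y) - E1 g1 * E1 g2).
  by move=> h; lra.
transitivity (E1 (fun x => (g1 x * g2 x + E1 (fun y => g1 y * g2 y)) +
    (- E1 g2 * g1 x + - E1 g1 * g2 x))).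
  apply: eq_E1 => x.
  transitivity (E1 (fun y => (g1 x * g2 x + g1 y * g2 y) +
      (- g1 x * g2 y + - g2 x * g1 y))).
    by apply: eq_E1 => y; ring.
  by rewrite !E1D E1_cst !E1Z; ring.
by rewrite !E1D !E1Z E1_cst; ring.
Qed.

Lemma harris n f1 f2 : antitone f1 -> antitone f2 ->
  Ex n f1 * Ex n f2 <= Ex n (fun s => f1 s * f2 s).
Proof.
elim: n f1 f2 => [|n IH] f1 f2 h1 h2 //=.
have hd f y : antitone f -> antitone (fun s => f (y :: s)).
  by move=> h s t st le_st; apply: h => /= [|[|i]//=]; rewrite ?st.
have hm f : antitone f ->
    {homo (fun y => Ex n (fun s => f (y :: s))) : x y / x <= y >-> y <= x}.
  by move=> h x y xy; apply: Ex_le => s _; apply: h => // -[|i] /=.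
apply: le_trans (E1_chebyshev (hm _ h1) (hm _ h2)) _.
by apply: E1_le => y; apply: IH; exact: hd.
Qed.

Definition decr A := forall s t, size s = size t ->
  (forall i, s`_i <= t`_i) -> A t -> A s.

Lemma decr_antitone A : decr A -> antitone (fun s => (A s)%:R).
Proof.
by move=> h s t e /(h _ _ e); case: (A t); case: (A s) => //= /(_ isT).
Qed.

Lemma decrI A B : decr A -> decr B -> decr (fun s => A s && B s).
Proof. by move=> a b s t e l /andP[/(a _ _ e l)-> /(b _ _ e l)->]. Qed.

Lemma harrisP n A B : decr A -> decr B ->
  Pr n A * Pr n B <= Pr n (fun s => A s && B s).
Proof.
move=> a b; apply: le_trans (harris _ (decr_antitone a) (decr_antitone b)) _.
by apply: Ex_le => s _; rewrite -natrM mulnb.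
Qed.

End FiniteExpectation.

(** * Stopped random walks *)

Section Walk.
Variable R : realType.
Implicit Types (a b u : R) (s t : seq R).

Definition sumr s : R := \sum_(y <- s) y.

Lemma sumr_cons y s : sumr (y :: s) = y + sumr s.
Proof. exact: big_cons. Qed.

Fixpoint alive b a s : bool :=
  if s is y :: s' then (a + y <= b) && alive b (a + y) s' else true.

Fixpoint stop b a s : R :=
  if s is y :: s' then if b < a + y then a + y else stop b (a + y) s' else a.

Fixpoint dur b a s : R :=
  if s is y :: s' then 1 + (if b < a + y then 0 else dur b (a + y) s') else 0.

Lemma stop_alive b a s : alive b a s -> stop b a s = a + sumr s.
Proof.
elim: s a => [|y s IH] a /=; first by rewrite /sumr big_nil addr0.
by case/andP => yb /IH ->; rewrite ltNge yb /= sumr_cons addrA.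
Qed.

Lemma stop_dead b a s : ~~ alive b a s -> b < stop b a s.
Proof.
elim: s a => [|y s IH] a //=; rewrite negb_and -ltNge.
by case: ifPn => //= _; exact: IH.
Qed.

Lemma alive_sumr b a s : a <= b -> alive b a s -> a + sumr s <= b.
Proof.
elim: s a => [|y s IH] a /=; first by rewrite /sumr big_nil addr0.
by move=> _ /andP[yb /IH]; rewrite sumr_cons addrA; exact.
Qed.

Lemma overshoot b a u s : 0 <= u -> a <= b ->
  stop b a s <= b + u + \sum_(y <- s) Num.max (y - u) 0.
Proof.
move=> u0; elim: s a => [|y s IH] a ab /=.
  by rewrite big_nil; lra.
have yu : y - u <= Num.max (y - u) 0 by rewrite le_max lexx.
have pos : 0 <= \sum_(y <- s) Num.max (y - u) 0.
  by apply: sumr_ge0 => i _; rewrite le_max lexx orbT.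
have y0 : 0 <= Num.max (y - u) 0 by rewrite le_max lexx orbT.
rewrite big_cons; case: ltP => h; first lra.
by have := IH _ h; lra.
Qed.

Lemma alive_decr b a : decr (alive b a).
Proof.
move=> s t; elim: s t a => [|x s IH] [|y t] a //= [st] le_st /andP[h1 h2].
have xy := le_st 0%N; rewrite /= in xy.
have shift c c' r : c <= c' -> alive b c' r -> alive b c r.
  elim: r c c' => [|z r IHr] c c' cc //= /andP[h3 h4].
  apply/andP; split; first lra.
  by apply: IHr h4; lra.
apply/andP; split; first lra.
apply: (IH t) => // [i|]; first by have := le_st i.+1.
by apply: shift h2; lra.
Qed.

Lemma aliveP b a s :
  reflect (forall n, (n < size s)%N -> a + sumr (take n.+1 s) <= b) (alive b a s).
Proof.
elim: s a => [|y s IH] a /=; first by left.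
apply: (iffP andP) => [[h1 /IH h2] [|n] hn|h].
- by rewrite take0 /sumr big_seq1.
- by rewrite sumr_cons addrA; exact: h2.
split; first by have := h 0%N isT; rewrite take0 /sumr big_seq1.
by apply/IH => n hn; have := h n.+1 hn; rewrite sumr_cons addrA.
Qed.

Lemma sumr_le s t : size s = size t -> (forall i, s`_i <= t`_i) ->
  sumr s <= sumr t.
Proof.
elim: s t => [|x s IH] [|y t] //= [st] h; rewrite !sumr_cons.
by apply: lerD; [exact: (h 0%N)|apply: IH => // i; exact: (h i.+1)].
Qed.

Variable L : finlaw R.
Local Notation Ex := (Ex L).
Local Notation E1 := (E1 L).
Local Notation Pr := (Pr L).

Hypothesis mean0 : E1 id = 0.
Let v2 := E1 (fun y => y ^+ 2).
Let m4 := E1 (fun y => y ^+ 4).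

Lemma E1_shift a : E1 (fun y => a + y) = a.
Proof. by rewrite E1D E1_cst mean0 addr0. Qed.

Lemma E1_shift2 a : E1 (fun y => (a + y) ^+ 2) = a ^+ 2 + v2.
Proof.
transitivity (E1 (fun y => a ^+ 2 + (2 * a * y + y ^+ 2))).
  by apply: eq_E1 => y; ring.
by rewrite !E1D E1_cst E1Z mean0 -/v2; ring.
Qed.

Lemma Ex_stop n b a : Ex n (stop b a) = a.
Proof.
elim: n a => [|n IH] a //=; rewrite -[RHS]E1_shift; apply: eq_E1 => y.
by case: (b < a + y); [exact: Ex_cst|exact: IH].
Qed.

Lemma Ex_stop2 n b a :
  Ex n (fun s => stop b a s ^+ 2) = a ^+ 2 + v2 * Ex n (dur b a).
Proof.
elim: n a => [|n IH] a /=; first by rewrite mulr0 addr0.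
transitivity (E1 (fun y => (a + y) ^+ 2 +
    v2 * (if b < a + y then 0 else Ex n (dur b (a + y))))).
  by apply: eq_E1 => y; case: (b < a + y); rewrite ?Ex_cst ?mulr0 ?addr0 ?IH.
rewrite E1D E1Z E1_shift2 -addrA; congr (_ + _).
rewrite -[X in X + _]mulr1 -mulrDr; congr (_ * _).
rewrite -[X in X + _](E1_cst L) -E1D; apply: eq_E1 => y.
by rewrite ExD Ex_cst; case: (b < a + y); rewrite ?Ex_cst.
Qed.

Lemma Ex_dur n b a : Ex n (dur b a) = \sum_(0 <= k < n) Pr k (alive b a).
Proof.
elim: n a => [|n IH] a /=; first by rewrite big_nil.
rewrite big_nat_recl// {1}/Pr/=.
transitivity (E1 (fun y => 1 + (if a + y <= b then
    \sum_(0 <= k < n) Pr k (alive b (a + y)) else 0))).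
  apply: eq_E1 => y; rewrite ExD Ex_cst; congr (_ + _).
  by rewrite ltNge; case: (a + y <= b) => /=; rewrite ?Ex_cst.
rewrite E1D E1_cst -E1_sum; congr (_ + _); apply: eq_E1 => y /=.
case: (a + y <= b) => /=; first by [].
by rewrite big1 => [|k _]; [|exact: (Ex_cst L k 0)].
Qed.

Lemma Ex_sumr n : Ex n sumr = 0.
Proof. by rewrite Ex_sum mean0 mulr0. Qed.

Lemma Ex_sumr2 n : Ex n (fun s => sumr s ^+ 2) = n%:R * v2.
Proof.
elim: n => [|n IH] /=; first by rewrite /sumr big_nil expr0n/= mul0r.
transitivity (E1 (fun y => y ^+ 2 + n%:R * v2)).
  apply: eq_E1 => y; rewrite -IH.
  transitivity (Ex n (fun s => y ^+ 2 + (2 * y * sumr s + sumr s ^+ 2))).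
    by apply: eq_Ex => s _; rewrite sumr_cons; ring.
  by rewrite !ExD Ex_cst ExZ Ex_sumr; ring.
by rewrite E1D E1_cst -natr1 -/v2; ring.
Qed.

Lemma v2_ge0 : 0 <= v2.
Proof. by rewrite -[leLHS](E1_cst L); apply: E1_le => y; exact: sqr_ge0. Qed.

Lemma sqr_v2_le : v2 ^+ 2 <= m4.
Proof.
have : 0 <= E1 (fun y => (y ^+ 2 - v2) ^+ 2).
  by rewrite -[leLHS](E1_cst L); apply: E1_le => y; exact: sqr_ge0.
suff -> : E1 (fun y => (y ^+ 2 - v2) ^+ 2) = m4 - v2 ^+ 2 by rewrite subr_ge0.
transitivity (E1 (fun y => y ^+ 4 + (- (2 * v2) * y ^+ 2 + v2 ^+ 2))).
  by apply: eq_E1 => y; ring.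
by rewrite !E1D E1_cst E1Z -/v2 -/m4; ring.
Qed.

Lemma Ex_sumr4 n : Ex n (fun s => sumr s ^+ 4) <= 3 * n%:R ^+ 2 * m4.
Proof.
elim: n => [|n IH] /=; first by rewrite /sumr big_nil !expr0n/= mulr0 ?mul0r.
pose c3 := Ex n (fun s => sumr s ^+ 3); pose c4 := Ex n (fun s => sumr s ^+ 4).
have -> : E1 (fun y => Ex n (fun s => sumr (y :: s) ^+ 4)) =
    m4 + 6 * (n%:R * v2) * v2 + c4.
  transitivity (E1 (fun y => y ^+ 4 + (6 * (n%:R * v2) * y ^+ 2 +
      (4 * c3 * y + c4)))).
    apply: eq_E1 => y.
    transitivity (Ex n (fun s => y ^+ 4 + (4 * y ^+ 3 * sumr s +
        (6 * y ^+ 2 * sumr s ^+ 2 + (4 * y * sumr s ^+ 3 + sumr s ^+ 4))))).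
      by apply: eq_Ex => s _; rewrite sumr_cons; ring.
    by rewrite !ExD Ex_cst !ExZ Ex_sumr Ex_sumr2 -/c3 -/c4; ring.
  by rewrite !E1D E1_cst !E1Z mean0 -/v2 -/m4; ring.
have := sqr_v2_le; have := v2_ge0; rewrite -natr1; move: IH; rewrite -/c4.
have n0 : 0 <= n%:R :> R by rewrite ler0n.
move=> h1 h2 h3; have : 0 <= n%:R * (m4 - v2 ^+ 2) by rewrite mulr_ge0 ?subr_ge0.
have : 0 <= m4 by rewrite (le_trans (sqr_ge0 v2)).
by move=> h4 h5; nra.
Qed.

End Walk.

Section WalkEstimates.
Variable R : realType.
Implicit Types (a b u v M : R).

Definition negK v M : R := 1 + 3 * M / (2 * v).
Definition negc v M : R := v / (4 * negK v M).
Definition alivec v M : R :=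
  Num.min 2^-1 (4 * (1 + M) * (1 + 6 / negc v M))^-1.

Lemma quartic_lower_bound (x b : R) : 0 < b ->
  4 * b ^+ 2 * x ^+ 2 - x ^+ 4 <= 4 * b ^+ 3 * `|x|.
Proof.
move=> b0; rewrite -[x ^+ 2]real_normK ?num_real//.
have -> : x ^+ 4 = `|x| ^+ 4.
  by rewrite -[4%N]/(2 * 2)%N !exprM real_normK ?num_real.
set r := `|x|; have r0 : 0 <= r by exact: normr_ge0.
have : 0 <= (r - 6 / 5 * b) ^+ 2 * (r + 12 / 5 * b).
  by rewrite mulr_ge0 ?sqr_ge0//; lra.
have : 0 <= b ^+ 2 * r by rewrite mulr_ge0 ?sqr_ge0.
have : 0 <= b ^+ 3 by rewrite exprn_ge0// ltW.
move=> h1 h2 h3; have : 0 <= 4 * b ^+ 3 - 4 * b ^+ 2 * r + r ^+ 3 by lra.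
by move=> /(mulr_ge0 r0); lra.
Qed.

Lemma sum_inv_sqrt n :
  \sum_(1 <= k < n.+1) (Num.sqrt k%:R)^-1 <= 2 * Num.sqrt n%:R :> R.
Proof.
elim: n => [|n IH]; first by rewrite big_geq// mulr_ge0.
rewrite big_nat_recr//=; apply: le_trans (lerD IH (lexx _)) _.
set r := Num.sqrt n%:R; set t := Num.sqrt n.+1%:R.
have r2 : r ^+ 2 = n%:R by rewrite sqr_sqrtr.
have t2 : t ^+ 2 = n%:R + 1 by rewrite sqr_sqrtr// natr1.
have r0 : 0 <= r by exact: sqrtr_ge0.
have t0 : 0 < t by rewrite sqrtr_gt0 ltr0n.
rewrite -subr_ge0; have -> : 2 * t - (2 * r + t^-1) = (2 * t ^+ 2 - 2 * r * t - 1) / t.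
  by field; rewrite gt_eqF.
rewrite divr_ge0 ?(ltW t0)//; have := sqr_ge0 (t - r).
by rewrite sqrrB; lra.
Qed.

Variables (v M : R).
Hypotheses (v0 : 0 < v) (M0 : 0 <= M).

Let K1 : 1 <= negK v M.
Proof. by rewrite lerDl divr_ge0 ?mulr_ge0// ltW. Qed.

Lemma negc_gt0 : 0 < negc v M.
Proof. by rewrite divr_gt0// mulr_gt0// (lt_le_trans ltr01 K1). Qed.

Lemma alivec_gt0 : 0 < alivec v M.
Proof.
rewrite lt_min invr_gt0 ltr0n/= invr_gt0 !mulr_gt0//; first by rewrite ltr_wpDr.
by rewrite ltr_wpDr// divr_ge0// ltW// negc_gt0.
Qed.

Variable L : finlaw R.
Local Notation Ex := (Ex L).
Local Notation E1 := (E1 L).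
Local Notation Pr := (Pr L).
Hypothesis mean0 : E1 id = 0.
Hypotheses (vL : v <= E1 (fun y => y ^+ 2)) (ML : E1 (fun y => y ^+ 4) <= M).

Lemma Ex_neg_ge n : (0 < n)%N ->
  negc v M * Num.sqrt n%:R <= Ex n (fun s => Num.max (- sumr s) 0).
Proof.
move=> n0; set K := negK v M; set r := Num.sqrt n%:R.
have r2 : r ^+ 2 = n%:R by rewrite sqr_sqrtr.
have r0 : 0 < r by rewrite sqrtr_gt0 ltr0n.
have K0 : 0 < K := lt_le_trans ltr01 K1.
have b0 : 0 < K * r by rewrite mulr_gt0.
set X := Ex n _.
have EX : Ex n (fun s => `|sumr s|) = 2 * X.
  rewrite -[RHS]addr0 -[X in _ + X](Ex_sumr mean0 n) -ExZ -ExD.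
  apply: eq_Ex => s _; case: (leP 0 (sumr s)) => h.
    by rewrite ger0_norm// max_r ?oppr_le0// mulr0 add0r.
  by rewrite ltr0_norm// max_l ?oppr_ge0 ?(ltW h)//; ring.
have KM : 3 * M <= 2 * K ^+ 2 * v.
  have h : 3 * M <= 2 * K * v.
    rewrite /K /negK mulrDr mulr1 mulrDl.
    have -> : 2 * (3 * M / (2 * v)) * v = 3 * M by field; rewrite gt_eqF.
    by rewrite lerDr mulr_ge0 ?ltW.
  apply: le_trans h _; rewrite ler_pM2r// ler_pM2l//.
  by rewrite expr2 ler_peMl// ltW.
have main : 4 * (K * r) ^+ 2 * (n%:R * E1 (fun y => y ^+ 2)) -
    3 * n%:R ^+ 2 * M <= 4 * (K * r) ^+ 3 * (2 * X).
  rewrite -EX -ExZ -Ex_sumr2// -ExZ.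
  apply: le_trans (_ : _ <= _ - Ex n (fun s => sumr s ^+ 4)) _.
    rewrite lerB//; apply: le_trans (Ex_sumr4 mean0 n) _.
    by rewrite ler_wpM2l// mulr_ge0// sqr_ge0.
  by rewrite -ExB; apply: Ex_le => s _; exact: quartic_lower_bound.
have : r ^+ 3 * (2 * K ^+ 2 * v * r) <= r ^+ 3 * (8 * K ^+ 3 * X).
  have -> : r ^+ 3 * (8 * K ^+ 3 * X) = 4 * (K * r) ^+ 3 * (2 * X) by ring.
  apply: le_trans main; rewrite -r2.
  have h : 0 <= 4 * K ^+ 2 * r ^+ 4 * (E1 (fun y => y ^+ 2) - v).
    by rewrite !mulr_ge0 ?subr_ge0 ?exprn_ge0// ltW.
  have h2 : 0 <= r ^+ 4 * (2 * K ^+ 2 * v - 3 * M).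
    by rewrite mulr_ge0 ?subr_ge0 ?exprn_ge0// ltW.
  by lra.
rewrite ler_pM2l ?exprn_gt0//.
have -> : 8 * K ^+ 3 * X = 2 * K ^+ 2 * (4 * K * X) by ring.
rewrite -!mulrA ler_pM2l// ler_pM2l ?exprn_gt0// !mulrA => h.
by rewrite /negc -/K mulrAC ler_pdivrMr ?mulr_gt0//; move: h; rewrite -!mulrA ler_pM2l//; lra.
Qed.

Lemma neg_antitone : antitone (fun s : seq R => Num.max (- sumr s) 0).
Proof.
move=> s t st h; rewrite ge_max le_max lerN2 sumr_le//= le_max lexx orbT//.
Qed.

(* Harris turns the optional stopping identity E[-S_n; alive] = E[S_T; dead]
   into a bound on P(alive), since alive and S_n^- are both decreasing. *)
Lemma alive_upper n b u : 0 <= b -> 0 <= u ->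
  n%:R * E1 (fun y => Num.max (y - u) 0) <= 1 ->
  negc v M * Num.sqrt n%:R * Pr n (alive b 0) <= 2 * b + u + 1.
Proof.
move=> b0 u0 hu; have [->|n0] := posnP n.
  by rewrite sqrtr0 mulr0 mul0r; lra.
apply: le_trans (_ : _ <= Ex n (fun s => Num.max (- sumr s) 0) * Pr n (alive b 0)) _.
  by rewrite ler_wpM2r ?Pr_ge0// Ex_neg_ge.
apply: le_trans (harris _ _ _ _) _; first exact: neg_antitone.
  exact/decr_antitone/alive_decr.
apply: le_trans (_ : _ <= Ex n (fun s => (2 * b + u) +
  (\sum_(y <- s) Num.max (y - u) 0 - stop b 0 s))) _.
  apply: Ex_le => s _.
  have := overshoot s u0 b0; have := @stop_alive _ b 0 s.
  have := @alive_sumr _ b 0 s b0.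
  have : 0 <= \sum_(y <- s) Num.max (y - u) 0.
    by apply: sumr_ge0 => i _; rewrite le_max lexx orbT.
  case: (alive b 0 s) => h1 h2 h3 h4.
    rewrite mulr1 h3// add0r; have := h2 isT; rewrite add0r => h5.
    by rewrite ge_max; apply/andP; split; lra.
  by rewrite mulr0; lra.
rewrite ExD Ex_cst ExB Ex_sum Ex_stop// subr0; lra.
Qed.

Lemma E1_sqr_le : E1 (fun y => y ^+ 2) <= 1 + M.
Proof.
apply: le_trans (_ : E1 (fun y => 1 + y ^+ 4) <= _).
  apply: E1_le => y; have -> : y ^+ 4 = (y ^+ 2) ^+ 2 by rewrite -exprM.
  by have := sqr_ge0 (y ^+ 2 - 1); have := sqr_ge0 y; rewrite sqrrB; lra.
by rewrite E1D E1_cst lerD2l.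
Qed.

Lemma alive_lower n b u : (0 < n)%N -> 0 <= u -> u + 1 <= b ->
  b <= Num.sqrt n%:R -> n%:R * E1 (fun y => Num.max (y - u) 0) <= 1 ->
  alivec v M * b <= Num.sqrt n%:R * Pr n (alive b 0).
Proof.
move=> n0 u0 ub bn hu; set r := Num.sqrt n%:R; set p := Pr n _.
have r1 : 1 <= r by rewrite -[leLHS]sqrtr1 ler_sqrt ?ler1n.
have r0 : 0 < r by lra.
have b0 : 0 < b by lra.
have p0 : 0 <= p by exact: Pr_ge0.
have c0 := alivec_gt0; have C0 := negc_gt0.
have [ph|ph] := leP 2^-1 p.
  rewrite mulrC; apply: ler_pM => //; [exact: ltW|exact: ltW|].
  by apply: le_trans ph; rewrite ge_min lexx.
have Edead : b / 2 <= Ex n (fun s => - sumr s * (alive b 0 s)%:R).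
  apply: le_trans (_ : _ <= Ex n (fun s => b * (~~ alive b 0 s)%:R - stop b 0 s)) _.
    by rewrite ExB ExZ Ex_stop// -/(Pr n _) PrC -/p subr0 ler_pM2l//; lra.
  apply: Ex_le => s _; have := @stop_alive _ b 0 s; have := @stop_dead _ b 0 s.
  case: (alive b 0 s) => /= h1 h2.
    by rewrite h2// mulr0 mulr1 !add0r.
  by have := h1 isT; rewrite mulr0 mulr1; lra.
pose Q := Ex n (fun s => stop b 0 s ^+ 2).
have Qle : Q <= (1 + M) * (1 + 6 / negc v M) * b * r.
  rewrite /Q Ex_stop2// expr0n/= add0r Ex_dur.
  rewrite -!mulrA; apply: ler_pM; first exact: v2_ge0.
  - by apply: sumr_ge0 => k _; exact: Pr_ge0.
  - exact: E1_sqr_le.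
  case: n n0 hu {Edead Q p ph p0 bn} @r r1 r0 => // n _ hu r r1 r0.
  rewrite big_nat_recl// mulrDl mul1r; apply: lerD.
    by apply: le_trans (Pr_le1 _ _ _) _; rewrite -[leLHS]mulr1 ler_pM//; lra.
  apply: le_trans (_ : _ <= \sum_(1 <= k < n.+1) 3 * b / negc v M * (Num.sqrt k%:R)^-1) _.
    rewrite big_add1/=; apply: ler_sum_nat => k /andP[_ kn].
    have k0 : 0 < Num.sqrt k.+1%:R :> R by rewrite sqrtr_gt0 ltr0n.
    have -> : 3 * b / negc v M / Num.sqrt k.+1%:R =
        3 * b / (negc v M * Num.sqrt k.+1%:R) by field; rewrite !gt_eqF.
    rewrite ler_pdivlMr; last exact: mulr_gt0.
    rewrite mulrC.
    apply: le_trans (_ : _ <= 2 * b + u + 1) _; last by lra.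
    apply: alive_upper => //; first exact: ltW.
    apply: le_trans hu; rewrite ler_wpM2r ?ler_nat ?ltnS ?(ltnW kn)//.
    by rewrite -[leLHS](E1_cst L); apply: E1_le => y; rewrite le_max lexx orbT.
  rewrite -mulr_sumr; apply: le_trans (_ : _ <= 3 * b / negc v M * (2 * r)) _.
    apply: ler_wpM2l; first exact: divr_ge0 (mulr_ge0 (ler0n _ 3) (ltW b0)) (ltW C0).
    apply: le_trans (sum_inv_sqrt n) _.
    by rewrite ler_pM2l// ler_sqrt ?ler_nat// ltr0n.
  by rewrite le_eqVlt; apply/orP; left; apply/eqP; field; rewrite gt_eqF.
have Qp : b ^+ 2 <= 4 * Q * p.
  have young th : 0 < th -> b / 2 <= th / 2 * Q + (2 * th)^-1 * p.
    move=> th0; apply: le_trans Edead _; rewrite -!ExZ -ExD; apply: Ex_le => s _.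
    have D0 : 0 <= (2 * th)^-1 by rewrite invr_ge0 mulr_ge0// ltW.
    have := @stop_alive _ b 0 s; case: (alive b 0 s) => h.
      rewrite h// add0r !mulr1.
      have : 0 <= th / 2 * (sumr s + th^-1) ^+ 2.
        by rewrite mulr_ge0 ?sqr_ge0 ?divr_ge0 ?ltW.
      have -> : th / 2 * (sumr s + th^-1) ^+ 2 =
          th / 2 * sumr s ^+ 2 + sumr s + (2 * th)^-1.
        by field; rewrite gt_eqF.
      by lra.
    by rewrite !mulr0 addr0 mulr_ge0 ?sqr_ge0 ?divr_ge0 ?ltW.
  have Q0 : 0 < Q.
    rewrite lt_neqAle eq_sym; apply/andP; split; last first.
      by apply: Ex_ge0 => s _; exact: sqr_ge0.
    apply/eqP => Q0; have := @young (2 * b^-1 * (p + 1)).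
    rewrite Q0 mulr0 add0r !mulr_gt0 ?invr_gt0// ?ltr_wpDl// => /(_ isT).
    rewrite !invfM invrK => h.
    have : b / 2 <= b / 4 * (p / (p + 1)) by lra.
    have : p / (p + 1) <= 1 by rewrite ler_pdivrMr ?ltr_wpDl//; lra.
    by move=> h1 h2; nra.
  have := @young (b / (2 * Q)); rewrite divr_gt0 ?mulr_gt0// => /(_ isT).
  have -> : b / (2 * Q) / 2 * Q = b / 4 by field; rewrite gt_eqF.
  have -> : (2 * (b / (2 * Q)))^-1 * p = Q * p / b by field; rewrite !gt_eqF.
  move=> h; have : b / 4 <= Q * p / b by lra.
  by rewrite ler_pdivlMr// expr2; lra.
have W0 : 0 < 4 * (1 + M) * (1 + 6 / negc v M).
  by rewrite !mulr_gt0 ?ltr_wpDr// divr_ge0// ltW.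
apply: le_trans (_ : _ <= (4 * (1 + M) * (1 + 6 / negc v M))^-1 * b) _.
  by rewrite ler_pM2r// ge_min lexx orbT.
rewrite mulrC ler_pdivrMr// -(ler_pM2l b0) -expr2.
apply: le_trans Qp _.
have := ler_wpM2r p0 Qle; lra.
Qed.

Lemma left_tail n : (0 < n)%N ->
  negc v M ^+ 2 / (2 * (1 + M)) <=
  Pr n (fun s => sumr s <= - (negc v M / 4 * Num.sqrt n%:R)).
Proof.
move=> n0; have := Ex_neg_ge n0; have := negc_gt0.
move: (negc v M) => c c0; set r := Num.sqrt n%:R => hneg; set p := Pr n _.
have r2 : r ^+ 2 = n%:R by rewrite sqr_sqrtr.
have r0 : 0 < r by rewrite sqrtr_gt0 ltr0n.
have N0 : 0 < 1 + M by rewrite ltr_wpDr.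
have young th : 0 < th -> c * r <= c / 4 * r + (th / 2 * (n%:R * E1 (fun y => y ^+ 2)) + (2 * th)^-1 * p).
  move=> th0; apply: le_trans hneg _.
  rewrite -[X in X + _](Ex_cst L n) -Ex_sumr2// -!ExZ -!ExD; apply: Ex_le => s _.
  have A0 : 0 <= c / 4 * r by rewrite mulr_ge0 ?divr_ge0 ?ltW.
  have B0 : 0 <= th / 2 * sumr s ^+ 2 by rewrite mulr_ge0 ?sqr_ge0 ?divr_ge0 ?ltW.
  case: (boolP (_ <= - (c / 4 * r))) => hs; last first.
    move: hs; rewrite -ltNge => hs.
    by rewrite ge_max mulr0; apply/andP; split; lra.
  have D0 : 0 <= (2 * th)^-1 by rewrite invr_ge0 mulr_ge0// ltW.
  rewrite mulr1 ge_max; apply/andP; split; last lra.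
  have : 0 <= th / 2 * (sumr s + th^-1) ^+ 2.
    by rewrite mulr_ge0 ?sqr_ge0 ?divr_ge0 ?ltW.
  have -> : th / 2 * (sumr s + th^-1) ^+ 2 = th / 2 * sumr s ^+ 2 + sumr s + (2 * th)^-1.
    by field; rewrite gt_eqF.
  by lra.
pose th := c / (2 * (1 + M) * r).
have th0 : 0 < th by apply: divr_gt0 => //; rewrite !mulr_gt0.
have h := young _ th0.
have h2 : th / 2 * (n%:R * E1 (fun y => y ^+ 2)) <= c * r / 4.
  apply: le_trans (_ : _ <= th / 2 * (r ^+ 2 * (1 + M))) _.
    rewrite r2; apply: ler_wpM2l; first by apply: divr_ge0 => //; exact: ltW.
    by apply: ler_wpM2l => //; exact: E1_sqr_le.
  by rewrite le_eqVlt; apply/orP; left; apply/eqP; rewrite /th; field; rewrite !gt_eqF.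
have h3 : c * r / 2 <= (2 * th)^-1 * p by lra.
rewrite ler_pdivrMr ?mulr_gt0//.
have : th * (c * r / 2) <= th * ((2 * th)^-1 * p) by rewrite ler_pM2l.
have -> : th * ((2 * th)^-1 * p) = p / 2 by field; rewrite gt_eqF.
have -> : th * (c * r / 2) = c ^+ 2 / (2 * (1 + M)) / 2.
  by rewrite /th; field; rewrite !gt_eqF.
rewrite ler_pM2r ?invr_gt0// ler_pdivrMr ?mulr_gt0//.
Qed.

End WalkEstimates.

(** * Moving averages *)

Section MovingAverage.
Variable R : realType.
Implicit Types (C : nat -> R) (s t : seq R) (x u h : R).

Definition conv C s n : R := \sum_(0 <= i < n) C (n.-1 - i)%N * s`_i.

Definition below C x s : bool :=
  all (fun n => conv C s n.+1 <= x) (iota 0 (size s)).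

Lemma belowP C x s :
  reflect (forall n, (n < size s)%N -> conv C s n.+1 <= x) (below C x s).
Proof.
apply: (iffP allP) => h n; first by move=> ns; apply: h; rewrite mem_iota.
by rewrite mem_iota => /andP[_]; exact: h.
Qed.

Lemma sumr_take s n : (n <= size s)%N -> sumr (take n s) = \sum_(0 <= i < n) s`_i.
Proof.
move=> ns; rewrite /sumr (big_nth 0) size_take_min (minn_idPl ns).
by apply: eq_big_nat => i /andP[_ hi]; rewrite nth_take.
Qed.

Lemma conv_le C s t n : (forall j, 0 <= C j) -> (forall i, s`_i <= t`_i) ->
  conv C s n <= conv C t n.
Proof. by move=> C0 st; apply: ler_sum => i _; exact: ler_wpM2l. Qed.

Lemma conv_take C s m n : (n <= m)%N -> conv C (take m s) n = conv C s n.
Proof.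
move=> nm; apply: eq_big_nat => i /andP[_ hi].
by rewrite nth_take// (leq_trans hi nm).
Qed.

Variables (C : nat -> R) (D : R).
Hypothesis CD : forall n, \sum_(0 <= j < n) `|C j - 1| <= D.

Lemma D_ge0 : 0 <= D.
Proof. by have := CD 0; rewrite big_nil. Qed.

Lemma normC_le j : `|C j| <= 1 + D.
Proof.
have h : `|C j - 1| <= D.
  apply: le_trans (CD j.+1); rewrite big_nat_recr//= lerDr.
  by apply: sumr_ge0.
have -> : C j = 1 + (C j - 1) by ring.
by apply: le_trans (ler_normD _ _) _; rewrite normr1 lerD2l.
Qed.

Lemma sum_rev_norm n : \sum_(0 <= i < n) `|C (n.-1 - i)%N - 1| <= D.
Proof.
apply: le_trans (CD n); rewrite [leRHS]big_nat_rev/=.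
rewrite le_eqVlt; apply/orP; left; apply/eqP.
apply: eq_big_nat => i /andP[_ hi]; congr (`|C _ - 1|).
by rewrite add0n -subn1 subnAC subn1 subnS.
Qed.

Lemma conv_close s n u : 0 <= u -> (n <= size s)%N -> (forall i, `|s`_i| <= u) ->
  `|conv C s n - sumr (take n s)| <= D * u.
Proof.
move=> u0 ns su; rewrite sumr_take// /conv -sumrB.
apply: le_trans (ler_norm_sum _ _ _) _.
apply: le_trans (_ : _ <= \sum_(0 <= i < n) `|C (n.-1 - i)%N - 1| * u) _.
  apply: ler_sum_nat => i /andP[_ hi].
  rewrite -{2}[s`_i]mul1r -mulrBl normrM; exact: ler_wpM2l.
by rewrite -mulr_suml ler_wpM2r// sum_rev_norm.
Qed.

Lemma nth_norm_le s u : 0 <= u -> ~~ has (fun y => u < `|y|) s ->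
  forall i, `|s`_i| <= u.
Proof.
move=> u0 /hasPn h i; have [si|si] := ltnP i (size s); last first.
  by rewrite nth_default// normr0.
by rewrite leNgt; apply: h; exact: mem_nth.
Qed.

Variable L : finlaw R.

Lemma Pr_le_has n (A B : seq R -> bool) (a : pred R) :
  (forall s, size s = n -> ~~ has a s -> A s -> B s) ->
  Pr L n A <= Pr L n B + n%:R * E1 L (fun y => (a y)%:R).
Proof.
move=> h; apply: le_trans (_ : _ <= Pr L n B + Pr L n (has a)) _.
  apply: Pr_le_add => s sn As; rewrite orbC -implyNb; apply/implyP => hh.
  exact: h.
by rewrite lerD2l; exact: Pr_has.
Qed.

Lemma Pr_below_le n x u : 0 <= u ->
  Pr L n (below C x) <= Pr L n (alive (x + D * u) 0) +
    n%:R * E1 L (fun y => (u < `|y|)%R%:R).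
Proof.
move=> u0; apply: Pr_le_has => s sn hh /belowP h.
apply/aliveP => k ks; rewrite add0r.
have := conv_close u0 ks (nth_norm_le u0 hh); have := h k ks.
by rewrite ler_norml => h1 /andP[h2 _]; lra.
Qed.

Lemma Pr_alive_le n h u : 0 <= u ->
  Pr L n (alive h 0) <= Pr L n (below C (h + D * u)) +
    n%:R * E1 L (fun y => (u < `|y|)%R%:R).
Proof.
move=> u0; apply: Pr_le_has => s sn hh /aliveP hs.
apply/belowP => k ks.
have := conv_close u0 ks (nth_norm_le u0 hh); have := hs k ks.
by rewrite ler_norml add0r => h1 /andP[_ h2]; lra.
Qed.

End MovingAverage.

Section PositiveCoefficients.
Variables (R : realType) (C : nat -> R) (D : R).
Hypothesis CD : forall n, \sum_(0 <= j < n) `|C j - 1| <= D.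
Hypothesis C0 : forall j, 0 <= C j.

Lemma decr_map (A : seq R -> bool) (f : R -> R) : {homo f : x y / x <= y} ->
  decr A -> decr (fun s => A (map f s)).
Proof.
move=> hf hA s t st h; apply: hA; rewrite ?size_map// => i.
have [si|si] := ltnP i (size s); last first.
  by rewrite !nth_default ?size_map// -st.
by rewrite !(nth_map 0) -?st//; exact: hf.
Qed.

Lemma decr_take (A : seq R -> bool) m : decr A -> decr (fun s => A (take m s)).
Proof.
move=> hA s t st h; apply: hA; first by rewrite !size_take st.
move=> i; have [im|im] := ltnP i m; first by rewrite !nth_take.
by rewrite !nth_default// size_take_min geq_min im.
Qed.

Lemma decr_drop (A : seq R -> bool) m : decr A -> decr (fun s => A (drop m s)).
Proof.
move=> hA s t st h; apply: hA; first by rewrite !size_drop st.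
by move=> i; rewrite !nth_drop.
Qed.

Lemma below_decr x : decr (below C x).
Proof.
move=> s t st h /belowP ht; apply/belowP => n ns.
by apply: le_trans (ht n _); rewrite -?st//; exact: conv_le.
Qed.

Lemma sumr_decr (x : R) : decr (fun s => sumr s <= x).
Proof. by move=> s t st h; apply: le_trans; exact: sumr_le. Qed.

Lemma all_decr (x : R) : decr (all (fun y => y <= x)).
Proof.
move=> s t st h /(all_nthP 0) ht; apply/(all_nthP 0) => i si.
by apply: le_trans (h i) (ht _ _); rewrite -st.
Qed.

Variables (L : finlaw R) (eta : R).
Local Notation shift := (map (fun y => y + eta)).

Definition qfin x n := Pr L n (fun s => below C x (shift s)).

Lemma sumr_map_shift s : sumr (shift s) = sumr s + (size s)%:R * eta.
Proof.
elim: s => [|y s IH] /=; first by rewrite /sumr !big_nil mul0r addr0.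
by rewrite !sumr_cons IH -natr1; ring.
Qed.

Lemma trunc_shift u s : ~~ has (fun y => u < `|y + eta|) s ->
  map (fun y => Num.max (y + eta) (- u)) s = shift s.
Proof.
elim: s => //= y s IH; rewrite negb_or -leNgt ler_norml => /andP[/andP[h _] /IH->].
by rewrite max_l.
Qed.

Lemma qfin_step m n x u h : (m <= n)%N -> 0 <= x -> 0 <= u -> n%:R * `|eta| <= 1 ->
  let e := n%:R * E1 L (fun y => (u < `|y + eta|)%R%:R) in
  let pm := Pr L m (fun s => sumr s <= - (h + D * u + 1)) in
  let pa := Pr L (n - m) (alive (h - 1) 0) in
  e <= pm -> e <= pa -> e <= 1 ->
  qfin x m * ((pm - e) * ((pa - e) * (1 - e))) <= qfin x n.
Proof.
move=> mn x0 u0 etan e pm pa epm epa e1.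
have uu0 : - u <= u by lra.
pose tr y := Num.max (y + eta) (- u).
have tr_homo : {homo tr : a b / a <= b}.
  move=> a b ab; rewrite /tr ge_max !le_max lexx orbT andbT.
  by rewrite lerD2r ab.
have sh_homo : {homo (fun y => y + eta) : a b / a <= b}.
  by move=> a b; rewrite lerD2r.
have hase k : (k <= n)%N -> k%:R * E1 L (fun y => (u < `|y + eta|)%R%:R) <= e.
  move=> kn; apply: ler_wpM2r; last by rewrite ler_nat.
  by rewrite -[leLHS](E1_cst L); apply: E1_le.
have etak k : (k <= n)%N -> `|k%:R * eta| <= 1.
  move=> kn; apply: le_trans etan; rewrite normrM normr_nat.
  by rewrite ler_wpM2r// ler_nat.
pose A1 s := below C x (shift (take m s)).
pose A2 s := sumr (map tr (take m s)) <= - (h + D * u).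
pose A3 s := alive h 0 (map tr (drop m s)).
pose A4 s := all (fun y => y <= u) (shift s).
have d1 : decr A1 by apply/(@decr_take (fun s => below C x (shift s)))/decr_map/below_decr.
have d2 : decr A2.
  by apply/(@decr_take (fun s => sumr (map tr s) <= _))/(@decr_map (fun s => sumr s <= _))/sumr_decr.
have d3 : decr A3 by apply/(@decr_drop (fun s => alive h 0 (map tr s)))/decr_map/alive_decr.
have d4 : decr A4 by apply/decr_map/all_decr.
have nE : n = (m + (n - m))%N by rewrite subnKC.
have P1 : Pr L n A1 = qfin x m.
  by rewrite {1}nE /Pr /A1 (Ex_take L m (n - m) (fun s => (below C x (shift s))%:R)).
have P2 : pm - e <= Pr L n A2.
  have -> : Pr L n A2 = Pr L m (fun s => sumr (map tr s) <= - (h + D * u)).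
    by rewrite {1}nE /Pr (Ex_take L m (n - m) (fun s => (sumr (map tr s) <= - (h + D * u))%R%:R)).
  rewrite lerBlDr; apply: le_trans (lerD (lexx _) (hase m mn)).
  apply: Pr_le_has => s sm hh hs; rewrite trunc_shift// sumr_map_shift sm.
  by have := etak m mn; rewrite ler_norml => /andP[_ ?]; lra.
have P3 : pa - e <= Pr L n A3.
  have -> : Pr L n A3 = Pr L (n - m) (fun s => alive h 0 (map tr s)).
    by rewrite {1}nE /Pr (Ex_drop L m (n - m) (fun s => (alive h 0 (map tr s))%:R)).
  rewrite lerBlDr; apply: le_trans (lerD (lexx _) (hase _ (leq_subr m n))).
  apply: Pr_le_has => s sm hh /aliveP hs.
  rewrite trunc_shift//; apply/aliveP => k; rewrite size_map => ks.
  rewrite -map_take sumr_map_shift add0r; have := hs k ks; rewrite add0r.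
  have : (size (take k.+1 s) <= n)%N.
    by rewrite size_take_min geq_min sm leq_subr orbT.
  by move=> /etak; rewrite ler_norml => /andP[_ ?]; lra.
have P4 : 1 - e <= Pr L n A4.
  rewrite lerBlDr -[leLHS](subrK (Pr L n A4)) -PrC addrC lerD2l.
  apply: le_trans (Pr_has _ _ _); apply: Pr_sub => s _.
  rewrite /A4 all_map -has_predC => /hasP[y ys /= hy]; apply/hasP; exists y => //.
  by rewrite ltr_normr [X in X || _]ltNge hy.
apply: le_trans (_ : _ <= Pr L n (fun s => A1 s && (A2 s && (A3 s && A4 s)))) _.
  apply: le_trans (harrisP L n d1 (decrI d2 (decrI d3 d4))).
  rewrite P1 ler_wpM2l ?Pr_ge0//.
  apply: le_trans (harrisP L n d2 (decrI d3 d4)).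
  apply: ler_pM => //; rewrite ?mulr_ge0 ?subr_ge0//.
  apply: le_trans (harrisP L n d3 d4).
  by apply: ler_pM => //; rewrite subr_ge0.
apply: Pr_sub => s sn /and4P[/belowP a1 a2 /aliveP a3 /allP a4].
apply/belowP => k; rewrite size_map sn => kn.
have [km|mk] := ltnP k m.
  have := a1 k; rewrite size_map size_take_min leq_min km sn kn => /(_ isT).
  by rewrite map_take conv_take.
pose t := map tr s.
have tu i : `|t`_i| <= u.
  have [si|si] := ltnP i (size s); last by rewrite nth_default ?size_map ?normr0.
  rewrite (nth_map 0)// ler_norml /tr le_max lexx orbT/= ge_max uu0 andbT.
  by apply: a4; apply/mapP; exists s`_i => //; exact: mem_nth.
apply: le_trans (_ : _ <= conv C t k.+1) _.
  apply: conv_le => // i; have [si|si] := ltnP i (size s); last first.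
    by rewrite !nth_default ?size_map.
  by rewrite !(nth_map 0)// /tr le_max lexx.
have kt : (k.+1 <= size t)%N by rewrite size_map sn.
have := conv_close CD u0 kt tu; rewrite ler_norml => /andP[_].
have -> : sumr (take k.+1 t) = sumr (map tr (take m s)) +
    sumr (take (k - m).+1 (map tr (drop m s))).
  rewrite -{1}(cat_take_drop m t) take_cat size_take_min size_map sn.
  rewrite (minn_idPl mn) ltnNge (leq_trans mk)//= /sumr big_cat/= /t map_take.
  by rewrite map_drop subSn.
have := a3 (k - m)%N; rewrite size_map size_drop sn ltn_sub2r ?(leq_ltn_trans mk)//.
by move=> /(_ isT); rewrite add0r; move: a2; rewrite /A2; lra.
Qed.

Lemma Pr_all n (a : pred R) : Pr L n (all a) = E1 L (fun y => (a y)%:R) ^+ n.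
Proof.
elim: n => [|n IH] //=; rewrite exprSr -E1Z; apply: eq_E1 => y.
rewrite -IH /=; case: (a y); rewrite ?mulr1 ?mulr0//=; exact: (Ex_cst L n 0).
Qed.

Lemma qfin_crude n x : 0 <= x ->
  E1 L (fun y => (y + eta <= 0)%R%:R) ^+ n <= qfin x n.
Proof.
move=> x0; rewrite -(Pr_all n (fun y => y + eta <= 0)).
apply: Pr_sub => s _ /allP h; apply/belowP => k _; apply: le_trans x0.
apply: sumr_le0 => i _; rewrite mulr_ge0_le0//.
have [si|si] := ltnP i (size s); last by rewrite nth_default ?size_map.
by rewrite (nth_map 0)//; apply: h; exact: mem_nth.
Qed.

End PositiveCoefficients.

(** * Exponential moments and growth of logarithms *)

Section Growth.
Variable R : realType.
Implicit Types (x y : R).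

Lemma pinfty_ge (r : R) : \forall x \near +oo, r <= x.
Proof. by apply: nbhs_pinfty_ge; exact: num_real. Qed.

Lemma exprn_le_expR (j : nat) (lam al : R) : 0 < lam -> 0 < al ->
  exists2 K : R, 0 < K & forall y, 0 <= y -> y ^+ j <= K * expR (lam * y `^ al).
Proof.
move=> lam0 al0; pose k := (Num.truncn (j%:R / al)).+1.
have kj : j%:R <= al * k%:R.
  by rewrite mulrC -ler_pdivrMr//; apply/ltW; rewrite truncnS_gt.
exists (1 + k`!%:R / lam ^+ k).
  by rewrite ltr_wpDr// divr_ge0// exprn_ge0// ltW.
move=> y y0; have [y1|/ltW y1] := leP y 1.
  rewrite -[leLHS]mulr1; apply: ler_pM => //; first exact: exprn_ge0.
    apply: le_trans (exprn_ile1 _ y0 y1) _.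
    by rewrite lerDl divr_ge0// exprn_ge0// ltW.
  by rewrite -expR0 ler_expR mulr_ge0 ?powR_ge0// ltW.
have t0 : 0 <= lam * y `^ al by rewrite mulr_ge0 ?powR_ge0// ltW.
have h := expR_ge1Dxn k.-1 t0; rewrite -/k in h.
rewrite -powR_mulrn//; apply: le_trans (ler_powR y1 kj) _.
rewrite powRrM powR_mulrn ?powR_ge0//.
have k0 : 0 < k`!%:R :> R by rewrite ltr0n fact_gt0.
have lk0 : 0 < lam ^+ k by rewrite exprn_gt0.
apply: le_trans (_ : _ <= k`!%:R / lam ^+ k * expR (lam * y `^ al)) _.
  apply: le_trans (_ : _ <= k`!%:R / lam ^+ k * ((lam * y `^ al) ^+ k / k`!%:R)) _.
    by rewrite exprMn le_eqVlt; apply/orP; left; apply/eqP; field; rewrite !gt_eqF.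
  by rewrite ler_wpM2l ?divr_ge0 ?(ltW lk0)//; apply: le_trans h; rewrite lerDr.
by rewrite ler_wpM2r ?expR_ge0// lerDr.
Qed.

Lemma polylog_le (be ep K : R) : 0 < ep ->
  \forall x \near +oo, K * ln x `^ be <= x `^ ep.
Proof.
move=> ep0; pose j := (Num.truncn `|be|).+1.
have jb : be <= j%:R.
  by apply: le_trans (ler_norm _) _; apply/ltW; rewrite truncnS_gt.
have e2 : 0 < ep / 2 by lra.
have [A A0 hA] := exprn_le_expR j e2 ltr01.
near=> x.
have x1 : 1 <= x by near: x; exact: pinfty_ge.
have x0 : 0 < x by lra.
have l1 : 1 <= ln x.
  by rewrite -[leLHS]expRK ler_ln ?posrE ?expR_gt0//.
have l0 : 0 <= ln x by lra.
apply: le_trans (_ : `|K| * ln x `^ be <= _).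
  by rewrite ler_wpM2r ?powR_ge0// ler_norm.
apply: le_trans (_ : `|K| * (A * expR (ep / 2 * ln x)) <= _).
  rewrite ler_wpM2l//; apply: le_trans (ler_powR l1 jb) _.
  by rewrite powR_mulrn//; have := hA _ l0; rewrite powRr1.
have -> : x `^ ep = expR (ep / 2 * ln x) * expR (ep / 2 * ln x).
  by rewrite -expRD /powR gt_eqF//; congr expR; field.
rewrite mulrA ler_wpM2r ?expR_ge0//.
have -> : expR (ep / 2 * ln x) = x `^ (ep / 2) by rewrite /powR gt_eqF.
have KA : 0 <= `|K| * A by rewrite mulr_ge0// ltW.
apply: le_trans (_ : ((`|K| * A) `^ (ep / 2)^-1) `^ (ep / 2) <= _).
  by rewrite -powRrM mulVf ?gt_eqF// powRr1.
by apply: ge0_ler_powR; rewrite ?nnegrE ?powR_ge0 ?ltW//.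
Unshelve. all: by end_near. Qed.

Lemma near_infty_natr (Q : R -> Prop) : (\forall x \near +oo, Q x) ->
  \forall n \near \oo, Q (n%:R).
Proof. by move=> h; exact: (cvgr_idn h). Qed.

Lemma near_pinfty_ln (Q : R -> Prop) : (\forall x \near +oo, Q x) ->
  \forall x \near +oo, Q (ln x).
Proof.
move=> [A [Ar hA]]; exists (expR A); split; rewrite ?num_real// => x hx.
apply: hA; rewrite -[A]expRK ltr_ln ?posrE ?expR_gt0//.
by rewrite (lt_trans _ hx)// expR_gt0.
Qed.

End Growth.

Section ExpClass.
Variables (R : realType) (lam al B v : R).
Hypotheses (lam0 : 0 < lam) (al0 : 0 < al) (v0 : 0 < v).

Definition exp_class (L : finlaw R) : Prop :=
  [/\ E1 L id = 0, v <= E1 L (fun y => y ^+ 2) &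
      E1 L (fun y => expR (lam * `|y| `^ al)) <= B].

Lemma exp_class_m4 : exists2 M : R, 0 <= M & forall L, exp_class L ->
  E1 L (fun y => y ^+ 4) <= M.
Proof.
have [K K0 hK] := exprn_le_expR 4 lam0 al0.
exists (K * `|B|) => [|L [_ _ LB]]; first by rewrite mulr_ge0// ltW.
apply: le_trans (_ : E1 L (fun y =>
  K * expR (lam * `|y| `^ al)) <= _).
  apply: E1_le => y; apply: le_trans (hK _ (normr_ge0 y)).
  by rewrite -[4%N]/(2 * 2)%N !exprM real_normK ?num_real.
by rewrite E1Z ler_pM2l//; apply: le_trans LB (ler_norm _).
Qed.

Lemma exp_class_tail L u : exp_class L -> 0 <= u ->
  E1 L (fun y => (u < `|y|)%R%:R) <= B * expR (- (lam * u `^ al)).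
Proof.
move=> [_ _ LB] u0; rewrite -ler_pdivrMr ?expR_gt0// mulrC -E1Z.
apply: le_trans LB; apply: E1_le => y; rewrite -expRN opprK.
case: ltP => h; last by rewrite mulr0 expR_ge0.
rewrite mulr1 ler_expR ler_pM2l//; apply: ge0_ler_powR; rewrite ?nnegrE//.
  exact: ltW.
exact: ltW.
Qed.

Lemma exp_class_excess : exists2 K : R, 0 < K & forall L u, exp_class L -> 0 <= u ->
  E1 L (fun y => Num.max (y - u) 0) <= K * expR (- (lam / 2 * u `^ al)).
Proof.
have l2 : 0 < lam / 2 by rewrite divr_gt0.
have [K K0 hK] := exprn_le_expR 1 l2 al0.
exists (K * (1 + `|B|)); first by rewrite mulr_gt0// ltr_wpDr.
move=> L u [_ _ LB] u0; rewrite -ler_pdivrMr ?expR_gt0// mulrC -E1Z.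
apply: le_trans (_ : E1 L (fun y => K * expR (lam * `|y| `^ al)) <= _); last first.
  rewrite E1Z ler_pM2l//; apply: le_trans LB _; apply: le_trans (ler_norm _) _.
  by rewrite lerDr.
apply: E1_le => y; rewrite -expRN opprK.
have [yu|uy] := leP (y - u) 0.
  by rewrite mulr0 mulr_ge0 ?expR_ge0// ltW.
have y0 : 0 < y by lra.
rewrite gtr0_norm//.
have -> : lam * y `^ al = lam / 2 * y `^ al + lam / 2 * y `^ al by lra.
rewrite expRD [K * _]mulrCA; apply: ler_pM; rewrite ?expR_ge0 ?(ltW uy)//.
  rewrite ler_expR ler_pM2l//; apply: ge0_ler_powR; rewrite ?nnegrE//; [exact: ltW|exact: ltW|lra].
by apply: le_trans (hK _ (ltW y0)); rewrite expr1; lra.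
Qed.

Definition ulev (n : nat) : R := (3 / lam * ln n%:R) `^ al^-1.

Lemma ulev_ge0 n : 0 <= ulev n. Proof. exact: powR_ge0. Qed.

Lemma lam_ulev n : (0 < n)%N -> lam * ulev n `^ al = 3 * ln n%:R.
Proof.
move=> n0; rewrite /ulev -powRrM mulVf ?gt_eqF// powRr1.
  by field; rewrite gt_eqF.
by rewrite mulr_ge0 ?divr_ge0 ?ln_ge0 ?ler1n// ltW.
Qed.

Lemma ulevE n : (0 < n)%N -> ulev n = (3 / lam) `^ al^-1 * ln n%:R `^ al^-1.
Proof.
by move=> n0; rewrite /ulev powRM ?divr_ge0 ?ln_ge0 ?ler1n// ltW.
Qed.

Lemma ulev_tail L n : exp_class L -> (0 < n)%N ->
  n%:R * E1 L (fun y => (ulev n < `|y|)%R%:R) <= B / n%:R ^+ 2.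
Proof.
move=> LC n0; have n0R : 0 < n%:R :> R by rewrite ltr0n.
apply: le_trans (_ : n%:R * (B * n%:R ^- 3) <= _).
  rewrite ler_pM2l//; apply: le_trans (exp_class_tail LC (ulev_ge0 n)) _.
  by rewrite lam_ulev// expRN expRM_natl lnK// posrE.
by rewrite le_eqVlt; apply/orP; left; apply/eqP; field; rewrite gt_eqF.
Qed.

Lemma ulev_excess : \forall n \near \oo, forall L, exp_class L ->
  n%:R * E1 L (fun y => Num.max (y - ulev n) 0) <= 1.
Proof.
have [K K0 hK] := exp_class_excess.
near=> n => L LC.
have n0 : (0 < n)%N by near: n; exists 1%N.
have n0R : 0 < n%:R :> R by rewrite ltr0n.
have Kn : K ^+ 2 <= n%:R by near: n; exact: nbhs_infty_ger.
apply: le_trans (_ : n%:R * (K * (n%:R * Num.sqrt n%:R)^-1) <= _).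
  rewrite ler_pM2l//; apply: le_trans (hK L _ LC (ulev_ge0 n)) _.
  rewrite ler_pM2l//.
  have -> : lam / 2 * ulev n `^ al = ln n%:R + 2^-1 * ln n%:R.
    have := lam_ulev n0; lra.
  rewrite expRN expRD lnK ?posrE// -powR12_sqrt ?ler0n// /powR gt_eqF//.
have s0 : 0 < Num.sqrt n%:R :> R by rewrite sqrtr_gt0.
have -> : n%:R * (K / (n%:R * Num.sqrt n%:R)) = K / Num.sqrt n%:R.
  by field; rewrite !gt_eqF.
rewrite ler_pdivrMr// mul1r.
by rewrite -(@ler_pXn2r _ 2%N) ?nnegrE ?(ltW K0) ?(ltW s0)// sqr_sqrtr// ltW.
Unshelve. all: by end_near. Qed.

End ExpClass.

(** * Bounds for finite laws *)

Section FiniteBounds.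
Variables (R : realType) (lam al B v : R).
Hypotheses (lam0 : 0 < lam) (al0 : 0 < al) (v0 : 0 < v).
Variables (C : nat -> R) (D : R).
Hypothesis CD : forall n, \sum_(0 <= j < n) `|C j - 1| <= D.

Let ex_class := exp_class lam al B v.
Let u := ulev lam al.

Let A0 : R := (3 / lam) `^ al^-1.
Let A0_ge0 : 0 <= A0. Proof. exact: powR_ge0. Qed.

Lemma powRNhalf (n : nat) : n%:R `^ (- 2^-1) = (Num.sqrt n%:R)^-1 :> R.
Proof. by rewrite powRN powR12_sqrt. Qed.

Lemma ln_ge1_near : \forall n \near \oo, 1 <= ln n%:R :> R.
Proof. exact: (near_infty_natr (near_pinfty_ln (pinfty_ge 1))). Qed.

Lemma sqrt_ge1 (n : nat) : (0 < n)%N -> 1 <= Num.sqrt n%:R :> R.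
Proof. by move=> n0; rewrite -[leLHS]sqrtr1 ler_sqrt// ler1n. Qed.

Lemma inv_sqr_le (n : nat) (b : R) : (0 < n)%N ->
  b / n%:R ^+ 2 <= `|b| / n%:R * (Num.sqrt n%:R)^-1.
Proof.
move=> n0; have n0R : 0 < n%:R :> R by rewrite ltr0n.
have s1 := sqrt_ge1 n0; have s0 : 0 < Num.sqrt n%:R :> R by lra.
have sn : Num.sqrt n%:R <= n%:R :> R.
  by rewrite -[leRHS]sqr_sqrtr ?ler0n// expr2 ler_peMl// ltW.
rewrite expr2 invfM mulrA; apply: le_trans (_ : `|b| / n%:R / n%:R <= _).
  by rewrite !ler_pM2r ?invr_gt0// ler_norm.
by rewrite ler_wpM2l ?divr_ge0// lef_pV2 ?posrE.
Qed.

Lemma half_le (q : R) : 0 <= q -> q / 2 <= q.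
Proof. by move=> h; lra. Qed.

Lemma half_le_sub (e p q : R) : e <= q / 2 -> q <= p -> q / 2 <= p - e.
Proof. by move=> h1 h2; lra. Qed.

Lemma fin_upper x : 0 <= x -> exists K : R, \forall n \near \oo,
  forall L, ex_class L ->
  Pr L n (below C x) <= K * (n%:R `^ (- 2^-1) * ln n%:R `^ al^-1).
Proof.
move=> x0; have D0 := D_ge0 CD.
have [M M0 hM] := exp_class_m4 B v lam0 al0.
have c0 := negc_gt0 v0 M0; set c := negc v M in c0.
exists ((2 * x + 1 + (2 * D + 1) * A0) / c + `|B|).
near=> n => L LC; have [mean0 vL LB] := LC.
have n0 : (0 < n)%N by near: n; exists 1%N.
have l1 : 1 <= ln n%:R :> R by near: n; exact: ln_ge1_near.
have n0R : 0 < n%:R :> R by rewrite ltr0n.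
have s1 := sqrt_ge1 n0; have s0 : 0 < Num.sqrt n%:R :> R by lra.
rewrite powRNhalf; set l := ln n%:R `^ al^-1.
have ll1 : 1 <= l.
  by rewrite /l -[leLHS](powRr0 (ln n%:R)) ler_powR// invr_ge0 ltW.
have uE : u n = A0 * l by exact: ulevE.
have u0 : 0 <= u n by exact: ulev_ge0.
apply: le_trans (Pr_below_le CD L n x u0) _.
rewrite mulrDl; apply: lerD; last first.
  apply: le_trans (ulev_tail lam0 al0 LC n0) _.
  apply: le_trans (inv_sqr_le _ n0) _.
  rewrite -mulrA; apply: ler_wpM2l => //.
  rewrite mulrC; apply: ler_wpM2l; first by rewrite invr_ge0 ltW.
  by apply: le_trans ll1; rewrite invf_le1// ler1n.
have hx : 0 <= x + D * u n by rewrite addr_ge0// mulr_ge0.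
have exc : n%:R * E1 L (fun y => Num.max (y - u n) 0) <= 1.
  by move: L LC {mean0 vL LB}; near: n; exact: ulev_excess.
have := alive_upper v0 M0 mean0 vL (hM _ LC) hx u0 exc; rewrite -/c => h.
have -> : (2 * x + 1 + (2 * D + 1) * A0) / c * ((Num.sqrt n%:R)^-1 * l) =
    (2 * x + 1 + (2 * D + 1) * A0) * l / (c * Num.sqrt n%:R).
  by field; rewrite !gt_eqF.
rewrite ler_pdivlMr; last exact: mulr_gt0.
rewrite mulrC; apply: le_trans h _; rewrite uE.
have : 0 <= (2 * x + 1) * (l - 1) by rewrite mulr_ge0 ?subr_ge0//; lra.
by lra.
Unshelve. all: by end_near. Qed.

Definition mlev (A : R) (n : nat) : nat := (Num.truncn (A * ln n%:R `^ (2 / al))).+1.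

Hypothesis C0 : forall j, 0 <= C j.

(* The walk is first pushed below level -h in m ~ h^2 steps, with h of the order
   of the largest of |Y_1|, ..., |Y_n|; afterwards the moving-average error
   cannot bring it back above 0 unless the walk itself climbs by h. *)
Lemma fin_step x : 0 <= x -> exists c0 : R, exists A : R, [/\ 0 < c0, 0 < A &
  \forall n \near \oo, (mlev A n <= n)%N /\ forall L eta, ex_class L ->
    n%:R * `|eta| <= 1 ->
    c0 / Num.sqrt n%:R * qfin C L eta x (mlev A n) <= qfin C L eta x n].
Proof.
move=> x0; have D0 := D_ge0 CD.
have [M M0 hM] := exp_class_m4 B v lam0 al0.
have c0 := negc_gt0 v0 M0; have a0 := alivec_gt0 v0 M0.
have lt := left_tail v0 M0; have alw := alive_lower v0 M0.
move: (negc v M) (alivec v M) c0 a0 lt alw => c a c0 a0 lt alw.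
pose kE := c ^+ 2 / (2 * (1 + M)).
have kE0 : 0 < kE by rewrite divr_gt0 ?exprn_gt0// mulr_gt0// ltr_wpDr.
pose A := (4 * (3 + D) * (A0 + 1) / c) ^+ 2.
have A1 : 0 < 4 * (3 + D) * (A0 + 1) / c.
  apply: divr_gt0 => //; apply: mulr_gt0; last by rewrite ltr_wpDl.
  by rewrite mulr_gt0// ltr_wpDr.
have A_gt0 : 0 < A by rewrite exprn_gt0.
exists (kE * a / 8), A; split=> //; first by rewrite divr_gt0// mulr_gt0.
near=> n.
have n0 : (0 < n)%N by near: n; exists 1%N.
have l1 : 1 <= ln n%:R :> R by near: n; exact: ln_ge1_near.
have n0R : 0 < n%:R :> R by rewrite ltr0n.
have s1 := sqrt_ge1 n0; have s0 : 0 < Num.sqrt n%:R :> R by lra.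
pose l : R := ln n%:R `^ al^-1.
have ll1 : 1 <= l.
  by rewrite /l -[leLHS](powRr0 (ln n%:R)) ler_powR// invr_ge0 ltW.
have uE : u n = A0 * l by exact: ulevE.
have u0 : 0 <= u n by exact: ulev_ge0.
have l2 : ln n%:R `^ (2 / al) = l ^+ 2.
  by rewrite -powR_mulrn ?powR_ge0// -powRrM mulrC.
have Al : 2 * A * l ^+ 2 <= n%:R / 2.
  suff : 4 * A * l ^+ 2 <= n%:R by move=> ?; lra.
  rewrite -l2 -[leRHS]powRr1 ?ler0n//.
  by near: n; exact: (near_infty_natr (polylog_le _ _ ltr01)).
have A0l : (A0 + 1) ^+ 2 * l ^+ 2 <= n%:R / 4.
  suff : 4 * (A0 + 1) ^+ 2 * l ^+ 2 <= n%:R by move=> ?; lra.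
  rewrite -l2 -[leRHS]powRr1 ?ler0n//.
  by near: n; exact: (near_infty_natr (polylog_le _ _ ltr01)).
have n8 : 8 <= n%:R :> R by near: n; exact: nbhs_infty_ger.
have Al0 : 0 <= A * l ^+ 2 by rewrite mulr_ge0 ?sqr_ge0// ltW.
set m := mlev A n.
have mlo : A * l ^+ 2 <= m%:R.
  by apply/ltW; rewrite /m /mlev l2 truncnS_gt.
have mhi : m%:R <= n%:R / 2 :> R.
  have h1 : (Num.truncn (A * l ^+ 2))%:R <= A * l ^+ 2 by rewrite truncn_le.
  have -> : m%:R = (Num.truncn (A * l ^+ 2))%:R + 1 :> R by rewrite natr1 /m /mlev l2.
  have Al' : 2 * (A * l ^+ 2) <= n%:R / 2 by rewrite mulrA.
  by move: (A * l ^+ 2) h1 Al0 Al' => t h1 t0 h2; lra.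
have mn : (m <= n)%N by rewrite -(ler_nat R); lra.
split=> // L eta LC heta; have [mean0 vL LB] := LC.
have eta1 : `|eta| <= 1.
  by apply: le_trans heta; rewrite ler_peMl// ler1n.
have nm : (0 < n - m)%N by rewrite subn_gt0 -(ltr_nat R); lra.
have nmR : n%:R / 2 <= (n - m)%:R :> R by rewrite natrB//; lra.
pose e := n%:R * E1 L (fun y => (u n + 1 < `|y + eta|)%R%:R).
have e_le : e <= `|B| / n%:R / Num.sqrt n%:R.
  apply: le_trans (inv_sqr_le _ n0).
  apply: le_trans (ulev_tail lam0 al0 LC n0); rewrite ler_pM2l//.
  apply: E1_le => y; case: (ltP (u n + 1)) => // h1; case: (ltP (ulev lam al n)) => // h2.
  by have := ler_normD y eta; move: h1 h2; rewrite -/(u n); lra.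
have e_small t : 0 < t -> 2 * `|B| / t <= n%:R -> e <= t / 2 / Num.sqrt n%:R.
  move=> t0; rewrite ler_pdivrMr// => hB; apply: le_trans e_le _.
  rewrite ler_pM2r ?invr_gt0// ler_pdivrMr//; lra.
have is1 : (Num.sqrt n%:R)^-1 <= 1 :> R by rewrite invf_le1.
have e1 : e <= 1 / 2.
  have := @e_small 1 ltr01; rewrite divr1 => h; apply: le_trans (h _) _.
    by near: n; exact: nbhs_infty_ger.
  by rewrite ler_piMr.
have ek : e <= kE / 2.
  apply: le_trans (e_small _ kE0 _) _; first by near: n; exact: nbhs_infty_ger.
  by rewrite ler_piMr// divr_ge0// ltW.
have ea : e <= a / 2 / Num.sqrt n%:R.
  by apply: e_small => //; near: n; exact: nbhs_infty_ger.
have exc : n%:R * E1 L (fun y => Num.max (y - u n) 0) <= 1.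
  by move: L LC {mean0 vL LB e e_le e_small e1 ek ea}; near: n; exact: ulev_excess.
pose h := u n + 2.
pose pm := Pr L m (fun s => sumr s <= - (h + D * (u n + 1) + 1)).
pose pa := Pr L (n - m) (alive (h - 1) 0).
have pmk : kE <= pm.
  apply: le_trans (lt L mean0 vL (hM _ LC) m isT) _; apply: Pr_sub => s _ hs.
  apply: le_trans hs _; rewrite lerN2.
  apply: le_trans (_ : (3 + D) * (A0 + 1) * l <= _).
    rewrite /h uE; have : 0 <= (3 + D) * (l - 1).
      by rewrite mulr_ge0 ?subr_ge0//; lra.
    have : 0 <= 2 * (A0 * l) by rewrite -uE mulr_ge0.
    by lra.
  have -> : (3 + D) * (A0 + 1) * l = c / 4 * (4 * (3 + D) * (A0 + 1) / c * l).
    by field; rewrite gt_eqF.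
  rewrite ler_pM2l ?divr_gt0//.
  have W0 : 0 <= 4 * (3 + D) * (A0 + 1) / c * l by apply: mulr_ge0; [exact: ltW|lra].
  by rewrite -[leLHS]ger0_norm// -sqrtr_sqr ler_wsqrtr// exprMn.
have pak : a / Num.sqrt n%:R <= pa.
  rewrite ler_pdivrMr// mulrC.
  have snm : Num.sqrt (n - m)%:R <= Num.sqrt n%:R :> R.
    by rewrite ler_wsqrtr// ler_nat leq_subr.
  apply: le_trans (_ : Num.sqrt (n - m)%:R * pa <= _); last first.
    by rewrite ler_wpM2r// Pr_ge0.
  apply: le_trans (alw L mean0 vL (hM _ LC) _ (h - 1) (u n) nm u0 _ _ _).
  - by rewrite ler_peMr ?(ltW a0)// /h; lra.
  - by rewrite /h; lra.
  - apply: le_trans (_ : (A0 + 1) * l <= _); first by rewrite /h uE; lra.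
    have A0l0 : 0 <= (A0 + 1) * l by rewrite mulr_ge0 ?addr_ge0//; lra.
    rewrite -[leLHS]ger0_norm// -sqrtr_sqr ler_wsqrtr// exprMn.
    by apply: le_trans A0l _; lra.
  apply: le_trans exc; apply: ler_wpM2r; last by rewrite ler_nat leq_subr.
  by rewrite -[leLHS](E1_cst L); apply: E1_le => y; rewrite le_max lexx orbT.
have u10 : 0 <= u n + 1 by lra.
have ia0 : 0 < a / Num.sqrt n%:R by rewrite divr_gt0.
have eas : a / 2 / Num.sqrt n%:R = a / Num.sqrt n%:R / 2 by rewrite mulrAC.
rewrite eas in ea.
have h1 : e <= pm := le_trans ek (le_trans (half_le (ltW kE0)) pmk).
have h2 : e <= pa := le_trans ea (le_trans (half_le (ltW ia0)) pak).
have h3 : e <= 1 := le_trans e1 (half_le ler01).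
have := @qfin_step _ C D CD C0 L eta m n x (u n + 1) h mn x0 u10 heta.
rewrite -/e -/pm -/pa => /(_ h1 h2 h3).
apply: le_trans; rewrite mulrC; apply: ler_wpM2l; first exact: Pr_ge0.
have -> : kE * a / 8 / Num.sqrt n%:R = kE / 2 * (a / Num.sqrt n%:R / 2 * (1 / 2)).
  by field; rewrite gt_eqF.
have kE2 : 0 <= kE / 2 := divr_ge0 (ltW kE0) (ler0n _ 2).
have ia2 : 0 <= a / Num.sqrt n%:R / 2 := divr_ge0 (ltW ia0) (ler0n _ 2).
apply: (ler_pM kE2 (mulr_ge0 ia2 _) (half_le_sub ek pmk)); first by rewrite divr_ge0.
apply: (ler_pM ia2 _ (half_le_sub ea pak) (half_le_sub e1 (lexx 1))).
by rewrite divr_ge0.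
Unshelve. all: by end_near. Qed.

End FiniteBounds.

Section IteratedLogs.
Variables (R : realType) (al A : R).
Hypotheses (al0 : 0 < al) (A0 : 0 < A).
Local Notation m := (mlev al A).
Let be : R := 2 / al.
Let be0 : 0 < be. Proof. by rewrite divr_gt0. Qed.

Lemma near_mlev (Q : nat -> Prop) : (\forall n \near \oo, Q n) ->
  \forall n \near \oo, Q (m n).
Proof.
move=> [n0 _ hQ]; near=> n; apply: hQ => /=.
rewrite -(ler_nat R).
have l1 : 1 <= ln n%:R :> R by near: n; exact: ln_ge1_near.
have h : (n0%:R / A) `^ be^-1 <= ln n%:R.
  by near: n; exact: (near_infty_natr (near_pinfty_ln (pinfty_ge _))).
apply/ltW; apply: le_lt_trans (truncnS_gt _).
rewrite mulrC -ler_pdivrMr//.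
apply: le_trans (_ : ((n0%:R / A) `^ be^-1) `^ be <= _).
  by rewrite -powRrM mulVf ?gt_eqF// powRr1// divr_ge0// ltW.
apply: ge0_ler_powR => //.
- exact: ltW.
- exact: powR_ge0.
- by rewrite nnegrE; lra.
Unshelve. all: by end_near. Qed.

Lemma mlev_le (n : nat) (K z : R) : (0 < n)%N -> 0 <= K -> 1 <= z -> ln n%:R <= K * z ->
  (m n)%:R <= (A * K `^ be + 1) * z `^ be.
Proof.
move=> n0 K0 z1 hn; have z0 : 0 <= z by lra.
have l0 : 0 <= ln n%:R :> R by rewrite ln_ge0// ler1n.
have zb : 1 <= z `^ be by rewrite -[leLHS](powRr0 z) ler_powR// ltW.
have h1 : ln n%:R `^ be <= K `^ be * z `^ be.
  rewrite -powRM//; apply: ge0_ler_powR => //; first exact: ltW.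
  by rewrite nnegrE mulr_ge0.
have h2 : A * ln n%:R `^ be <= A * (K `^ be * z `^ be) by rewrite ler_pM2l.
have h3 : (Num.truncn (A * ln n%:R `^ be))%:R <= A * ln n%:R `^ be.
  by rewrite truncn_le// mulr_ge0 ?powR_ge0// ltW.
rewrite /mlev -natr1 -/be mulrDl mul1r -mulrA; apply: lerD => //.
exact: le_trans h3 h2.
Qed.

Lemma ln_mlev_le (n : nat) (K z : R) : 1 <= K -> 1 <= ln z -> 0 < z ->
  (0 < n)%N -> n%:R <= K * z `^ be -> ln n%:R <= (ln K + be) * ln z.
Proof.
move=> K1 lz z0 n0 hn; have K0 : 0 < K by lra.
have zb : 0 < z `^ be by rewrite powR_gt0.
apply: le_trans (_ : ln (K * z `^ be) <= _).
  by rewrite ler_ln ?posrE ?mulr_gt0// ltr0n.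
rewrite lnM ?posrE// ln_powR mulrDl lerD2r ler_peMr// ln_ge0//.
Qed.

Lemma mlev_growth (K : R) : 0 <= K -> exists K1 K2 : R, [/\ 1 <= K1, 0 <= K2 &
  forall n z, (0 < n)%N -> 1 <= z -> ln n%:R <= K * z ->
    (m n)%:R <= K1 * z `^ be /\ (1 <= ln z -> ln (m n)%:R <= K2 * ln z)].
Proof.
move=> K0; have K1 : 1 <= A * K `^ be + 1.
  by rewrite lerDr mulr_ge0 ?powR_ge0// ltW.
exists (A * K `^ be + 1), (ln (A * K `^ be + 1) + be); split => //.
  by rewrite addr_ge0 ?(ltW be0)// ln_ge0.
move=> n z n0 z1 hn; have h := mlev_le n0 K0 z1 hn; split => // lz.
by apply: ln_mlev_le => //; lra.
Qed.

Lemma iterated_mlev_bound (k K ep : R) : 0 < k -> 0 < ep ->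
  \forall n \near \oo,
    `|K| * Num.sqrt (m n)%:R * Num.sqrt (m (m n))%:R <=
    ln n%:R `^ (al^-1 + ep) * expR (- (k * (m (m (m n)))%:R)).
Proof.
move=> k0 ep0.
have [K1 [K1' [K1_1 K1'0 g1]]] := mlev_growth ler01.
have [K2 [K2' [K2_1 K2'0 g2]]] := mlev_growth K1'0.
have [K3 [K3' [_ _ g3]]] := mlev_growth K2'0.
have [Q Q1 hQ] : exists2 Q : R, 1 <= Q & `|K| * Num.sqrt K1 * Num.sqrt K2 <= Q.
  exists (`|K| * Num.sqrt K1 * Num.sqrt K2 + 1); last by rewrite lerDl.
  by rewrite lerDr !mulr_ge0 ?sqrtr_ge0.
near=> n.
have n0 : (0 < n)%N by near: n; exists 1%N.
pose l : R := ln n%:R; pose y := ln l.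
have y1 : 1 <= y.
  by rewrite /y /l; near: n; exact: (near_infty_natr (near_pinfty_ln (near_pinfty_ln (pinfty_ge _)))).
have ly1 : 1 <= ln y.
  by rewrite /y /l; near: n; exact: (near_infty_natr (near_pinfty_ln (near_pinfty_ln (near_pinfty_ln (pinfty_ge _))))).
have l1 : 1 <= l.
  by rewrite /y /l; near: n; exact: (near_infty_natr (near_pinfty_ln (pinfty_ge _))).
have l0 : 0 < l := lt_le_trans ltr01 l1.
have y0 : 0 < y := lt_le_trans ltr01 y1.
have ly0 : 0 <= ln y := le_trans ler01 ly1.
have lnl : ln n%:R <= 1 * l by rewrite mul1r.
have [n2 /(_ y1) ln2] := g1 n l n0 l1 lnl.
have [n3 /(_ ly1) ln3] := g2 (m n) y isT y1 ln2.
have [n4 _] := g3 (m (m n)) (ln y) isT ly1 ln3.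
move: n2 n3 n4 {ln2 ln3 g1 g2 g3}; rewrite -/l.
move: (m (m (m n))) => k3; move: (m (m n)) => k2; move: (m n) => k1 n2 n3 n4.
have sq (t K' z : R) : 0 <= K' -> 0 <= z -> t <= K' * z `^ be ->
    Num.sqrt t <= Num.sqrt K' * z `^ al^-1.
  move=> K'0 z0 ht; apply: le_trans (_ : Num.sqrt (K' * z `^ be) <= _).
    exact: ler_wsqrtr.
  rewrite sqrtrM// -[Num.sqrt (z `^ be)]powR12_sqrt ?powR_ge0// -powRrM.
  by rewrite /be mulrAC mulfV// mul1r.
have s2 : Num.sqrt k1%:R <= Num.sqrt K1 * l `^ al^-1.
  exact: sq (le_trans ler01 K1_1) (ltW l0) n2.
have s3 : Num.sqrt k2%:R <= Num.sqrt K2 * y `^ al^-1.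
  exact: sq (le_trans ler01 K2_1) (ltW y0) n3.
have b1 : ln Q * (3 / ep) <= y.
  by rewrite /y /l; near: n; exact: (near_infty_natr (near_pinfty_ln (near_pinfty_ln (pinfty_ge _)))).
have b2 : al^-1 * (3 / ep) * ln y `^ 1 <= y `^ 1.
  by rewrite /y /l; near: n; exact: (near_infty_natr (near_pinfty_ln (near_pinfty_ln (polylog_le _ _ ltr01)))).
have b3 : k * K3 * (3 / ep) * ln y `^ be <= y `^ 1.
  by rewrite /y /l; near: n; exact: (near_infty_natr (near_pinfty_ln (near_pinfty_ln (polylog_le _ _ ltr01)))).
rewrite (powRr1 ly0) (powRr1 (ltW y0)) in b2; rewrite (powRr1 (ltW y0)) in b3.
have e3 : 0 < 3 / ep by rewrite divr_gt0.
have key : ln Q + al^-1 * ln y + k * k3%:R <= ep * y.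
  have h1 : ln Q <= ep / 3 * y.
    by rewrite -(ler_pM2r e3); apply: le_trans b1 _; rewrite le_eqVlt; apply/orP; left; apply/eqP; field; rewrite gt_eqF.
  have h2 : al^-1 * ln y <= ep / 3 * y.
    rewrite -(ler_pM2r e3) mulrAC; apply: le_trans b2 _; rewrite le_eqVlt; apply/orP; left; apply/eqP; field; rewrite gt_eqF//.
  have h3 : k * k3%:R <= ep / 3 * y.
    apply: le_trans (ler_wpM2l (ltW k0) n4) _.
    rewrite -(ler_pM2r e3).
    have -> : k * (K3 * ln y `^ be) * (3 / ep) = k * K3 * (3 / ep) * ln y `^ be by ring.
    apply: le_trans b3 _; rewrite le_eqVlt; apply/orP; left; apply/eqP; field; rewrite gt_eqF//.
  have -> : ep * y = ep / 3 * y + ep / 3 * y + ep / 3 * y by field.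
  by apply: lerD => //; exact: lerD.
rewrite expRN ler_pdivlMr ?expR_gt0// powRD; last first.
  by rewrite gt_eqF// addr_gt0// invr_gt0.
apply: le_trans (_ : Q * (l `^ al^-1 * y `^ al^-1) * expR (k * k3%:R) <= _).
  rewrite ler_pM2r ?expR_gt0//.
  apply: le_trans (_ : `|K| * (Num.sqrt K1 * l `^ al^-1) * (Num.sqrt K2 * y `^ al^-1) <= _).
    apply: ler_pM => //; rewrite ?mulr_ge0 ?sqrtr_ge0//.
    exact: ler_wpM2l.
  have -> : `|K| * (Num.sqrt K1 * l `^ al^-1) * (Num.sqrt K2 * y `^ al^-1) =
      `|K| * Num.sqrt K1 * Num.sqrt K2 * (l `^ al^-1 * y `^ al^-1) by ring.
  by rewrite ler_wpM2r ?mulr_ge0 ?powR_ge0.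
rewrite mulrCA -!mulrA ler_wpM2l ?powR_ge0//.
have Q0 : 0 < Q := lt_le_trans ltr01 Q1.
have -> : l `^ ep = expR (ep * y) by rewrite /powR gt_eqF.
have -> : Q * (y `^ al^-1 * expR (k * k3%:R)) =
    expR (ln Q + al^-1 * ln y + k * k3%:R).
  by rewrite !expRD lnK ?posrE// /powR (gt_eqF y0) mulrA.
by rewrite ler_expR.
Unshelve. all: by end_near. Qed.

End IteratedLogs.

Section FiniteLower.
Variables (R : realType) (lam al B v : R).
Hypotheses (lam0 : 0 < lam) (al0 : 0 < al) (v0 : 0 < v).
Variables (C : nat -> R) (D : R).
Hypothesis CD : forall n, \sum_(0 <= j < n) `|C j - 1| <= D.
Hypothesis C0 : forall j, 0 <= C j.

(* Three rounds of [fin_step] bring the horizon n down to a power of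
   log log log n, where the crude exponential bound costs only (log n)^o(1). *)
Lemma fin_lower x ep : 0 <= x -> 0 < ep -> \forall n \near \oo,
  forall L eta, exp_class lam al B v L -> n%:R * `|eta| <= 1 ->
  2 * (n%:R `^ (- 2^-1) * ln n%:R `^ (- al^-1 - ep)) <= qfin C L eta x n.
Proof.
move=> x0 ep0.
have [c [A [c0 A0 hstep]]] := fin_step B lam0 al0 v0 CD C0 x0.
have [M M0 hM] := exp_class_m4 B v lam0 al0.
have d0 := negc_gt0 v0 M0; have lt := left_tail v0 M0.
move: (negc v M) d0 lt => d d0 lt.
pose kE := d ^+ 2 / (2 * (1 + M)).
have kE0 : 0 < kE by rewrite divr_gt0 ?exprn_gt0// mulr_gt0// ltr_wpDr.
pose k := `|ln kE| + 1.
have k0 : 0 < k by rewrite ltr_wpDl.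
have kk : expR (- k) <= kE.
  rewrite -[leRHS]lnK ?posrE// ler_expR /k lerNl.
  by apply: le_trans (_ : `|ln kE| <= _); [rewrite -normrN ler_norm|rewrite lerDl].
near=> n => L eta LC heta; have [mean0 vL LB] := LC.
have n0 : (0 < n)%N by near: n; exists 1%N.
have l1 : 1 <= ln n%:R :> R by near: n; exact: ln_ge1_near.
set m := mlev al A.
have [h1 h2 h3] : [/\ (m n <= n)%N /\ (forall L eta, exp_class lam al B v L ->
    n%:R * `|eta| <= 1 ->
    c / Num.sqrt n%:R * qfin C L eta x (m n) <= qfin C L eta x n),
   (m (m n) <= m n)%N /\ (forall L eta, exp_class lam al B v L ->
    (m n)%:R * `|eta| <= 1 ->
    c / Num.sqrt (m n)%:R * qfin C L eta x (m (m n)) <= qfin C L eta x (m n)) &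
   (m (m (m n)) <= m (m n))%N /\ (forall L eta, exp_class lam al B v L ->
    (m (m n))%:R * `|eta| <= 1 ->
    c / Num.sqrt (m (m n))%:R * qfin C L eta x (m (m (m n))) <= qfin C L eta x (m (m n)))].
  split; near: n; first exact: hstep.
    exact: (near_mlev al0 A0 hstep).
  exact: (near_mlev al0 A0 (near_mlev al0 A0 hstep)).
have [mn q1] := h1; have [mmn q2] := h2; have [_ q3] := h3.
have eta2 : (m n)%:R * `|eta| <= 1.
  by apply: le_trans heta; rewrite ler_wpM2r// ler_nat.
have eta3 : (m (m n))%:R * `|eta| <= 1.
  by apply: le_trans eta2; rewrite ler_wpM2r// ler_nat.
have q4 : expR (- (k * (m (m (m n)))%:R)) <= qfin C L eta x (m (m (m n))).
  apply: le_trans (qfin_crude C0 L eta _ x0).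
  rewrite -mulNr expRM_natr; apply: lerXn2r; rewrite ?nnegrE ?expR_ge0//.
    by rewrite -[leLHS](E1_cst L); apply: E1_le.
  apply: le_trans kk (le_trans (lt L mean0 vL (hM _ LC) 1 isT) _).
  rewrite sqrtr1 mulr1; apply: E1_le => y /=; rewrite /sumr big_seq1.
  have [hy|_] := leP y (- (d / 4)); last exact: ler0n.
  have [//|hy2] := leP (y + eta) 0.
  have : 4 / d <= n%:R by near: n; exact: nbhs_infty_ger.
  rewrite ler_pdivrMr// => nd.
  have : eta <= d / 4.
    apply: le_trans (ler_norm _) _; rewrite ler_pdivlMr//.
    have n0R : 0 < n%:R :> R by rewrite ltr0n.
    by rewrite -(ler_pM2l n0R) mulrA; apply: le_trans nd; lra.
  by lra.
have s n' : (0 < n')%N -> 0 < Num.sqrt n'%:R :> R.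
  by move=> ?; rewrite sqrtr_gt0 ltr0n.
have sn := s _ n0; have sm := s (m n) isT; have smm := s (m (m n)) isT.
have cs n' : 0 <= c / Num.sqrt n'%:R by rewrite divr_ge0 ?sqrtr_ge0// ltW.
apply: le_trans (q1 _ _ LC heta).
apply: le_trans (ler_wpM2l (cs _) (q2 _ _ LC eta2)).
apply: le_trans (ler_wpM2l (cs _) (ler_wpM2l (cs _) (q3 _ _ LC eta3))).
apply: le_trans (ler_wpM2l (cs _) (ler_wpM2l (cs _) (ler_wpM2l (cs _) q4))).
have key : `|2 / c ^+ 3| * Num.sqrt (m n)%:R * Num.sqrt (m (m n))%:R <=
    ln n%:R `^ (al^-1 + ep) * expR (- (k * (m (m (m n)))%:R)).
  by near: n; exact: iterated_mlev_bound.
have c3 : 0 < c ^+ 3 by rewrite exprn_gt0.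
rewrite ger0_norm in key; last by rewrite divr_ge0// ltW.
rewrite powRNhalf -opprD powRN; set z := ln n%:R `^ _ in key *.
have z0 : 0 < z by rewrite powR_gt0// (lt_le_trans ltr01 l1).
move: (expR _) (Num.sqrt n%:R) (Num.sqrt (m n)%:R) (Num.sqrt (m (m n))%:R) sn sm smm key.
clear -c0 c3 z0 => E r1 r2 r3 r10 r20 r30 key.
have -> : 2 * ((r1)^-1 * z^-1) = 2 / (r1 * z).
  by field; rewrite !gt_eqF.
rewrite ler_pdivrMr; last exact: mulr_gt0.
have -> : c / r1 * (c / r2 * (c / r3 * E)) *
    (r1 * z) = c ^+ 3 * (z * E) / (r2 * r3).
  by field; rewrite !gt_eqF.
rewrite ler_pdivlMr; last exact: mulr_gt0.
have -> : 2 * (r2 * r3) =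
    c ^+ 3 * (2 / c ^+ 3 * r2 * r3).
  by field; rewrite gt_eqF.
by rewrite ler_pM2l.
Unshelve. all: by end_near. Qed.

End FiniteLower.

(** * Discretisation of the innovations *)

Section Grid.
Variables (R : realType) (U : R) (K : nat).
Hypotheses (U0 : 0 < U) (K0 : (0 < K)%N).

Definition mesh : R := 2 * U / K%:R.
Definition gridpt (i : nat) : R := - U + i%:R * mesh.
Definition cellnum (y : R) : nat := find (fun i => y <= gridpt i) (iota 0 K).
Definition cellidx (y : R) : 'I_K.+1 := inord (cellnum y).
Definition roundup (y : R) : R := gridpt (cellidx y).

Let mesh0 : 0 < mesh. Proof. by rewrite divr_gt0 ?mulr_gt0// ltr0n. Qed.

Lemma gridptK : gridpt K = U.
Proof. by rewrite /gridpt /mesh; field; rewrite pnatr_eq0 -lt0n. Qed.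

Lemma cellnum_le y : (cellnum y <= K)%N.
Proof. by rewrite -[leqRHS](size_iota 0); exact: find_size. Qed.

Lemma cellidxE y : cellidx y = cellnum y :> nat.
Proof. by rewrite inordK// ltnS cellnum_le. Qed.

Lemma roundup_ge y : y <= U -> y <= roundup y.
Proof.
move=> yU; rewrite /roundup cellidxE /cellnum; set p := fun i => _.
have [h|h] := boolP (has p (iota 0 K)).
  have := nth_find 0%N h; rewrite nth_iota ?add0n//.
  by rewrite has_find size_iota in h.
by rewrite hasNfind// size_iota gridptK.
Qed.

Lemma roundup_le y : - U <= y -> roundup y <= y + mesh.
Proof.
move=> yU; rewrite /roundup cellidxE; have := cellnum_le y.
case E : (cellnum y) => [|j] jK.
  by rewrite /gridpt mul0r addr0 ler_wpDr// ltW.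
have jf : (j < cellnum y)%N by rewrite E.
have := before_find 0%N jf; rewrite nth_iota// add0n => /negbT; rewrite -ltNge => h.
by rewrite /gridpt -natr1 mulrDl mul1r addrA lerD2r ltW.
Qed.

Lemma roundup_norm y : `|roundup y| <= U.
Proof.
rewrite /roundup; set i := cellidx y; rewrite ler_norml -{2}gridptK /gridpt.
rewrite lerDl lerD2l mulr_ge0 ?(ltW mesh0)//=.
by rewrite ler_pM2r// ler_nat -ltnS.
Qed.

Lemma roundup_close y : `|y| <= U -> `|roundup y - y| <= mesh.
Proof.
rewrite ler_norml => /andP[h1 h2]; have := roundup_ge h2; have := roundup_le h1.
by move=> h3 h4; rewrite ger0_norm ?subr_ge0//; lra.
Qed.

Lemma roundup_norm_le y : `|roundup y| <= `|y| + mesh.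
Proof.
have [yU|/ltW yU] := leP `|y| U.
  have -> : roundup y = y + (roundup y - y) by ring.
  by apply: le_trans (ler_normD _ _) _; rewrite lerD2l roundup_close.
apply: le_trans (roundup_norm y) _; apply: le_trans yU _.
by rewrite lerDl ltW.
Qed.

Lemma roundup_dist y : `|roundup y - y| <= mesh + 2 / U * y ^+ 2.
Proof.
have [yU|yU] := leP `|y| U.
  apply: le_trans (roundup_close yU) _.
  by rewrite lerDl mulr_ge0 ?sqr_ge0// divr_ge0// ltW.
apply: le_trans (_ : 2 / U * y ^+ 2 <= _); last by rewrite lerDr ltW.
apply: le_trans (ler_normB _ _) _; apply: le_trans (_ : 2 * `|y| <= _).
  by have := roundup_norm y; lra.
rewrite -[y ^+ 2]real_normK ?num_real// -mulrA ler_pM2l// mulrC.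
rewrite ler_pdivlMr// expr2 ler_wpM2l// ltW//.
Qed.

Lemma measurable_find s i : measurable [set y : R | find (fun j => y <= gridpt j) s = i].
Proof.
elim: s i => [|x s IH] i /=.
  have [->|i0] := eqVneq i 0%N.
    by rewrite (_ : [set _ | _] = setT)//; apply/seteqP.
  rewrite (_ : [set _ | _] = set0)//; apply/seteqP; split => // y /= e.
  by rewrite e eqxx in i0.
have m1 : measurable [set y : R | y <= gridpt x].
  by rewrite -set_itvNyc; exact: measurable_itv.
case: i => [|i].
  rewrite (_ : [set _ | _] = [set y : R | y <= gridpt x])//.
  by apply/seteqP; split => y /=; case: ifP.
rewrite (_ : [set _ | _] = ~` [set y : R | y <= gridpt x] `&`
    [set y : R | find (fun j => y <= gridpt j) s = i]).
  by apply: measurableI => //; exact: measurableC.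
apply/seteqP; split => y /=; first by case: ifP => // /negbT/negP h [<-].
by case=> /negP/negbTE -> <-.
Qed.

Lemma measurable_cell (i : 'I_K.+1) : measurable [set y | cellidx y = i].
Proof.
rewrite (_ : [set _ | _] = [set y | cellnum y = i]); first exact: measurable_find.
apply/seteqP; split => y /= h; first by rewrite -h cellidxE.
by apply/val_inj; rewrite /= cellidxE.
Qed.

End Grid.

Section DiscreteLaw.
Context d (T : measurableType d) (R : realType) (P : probability T R).
Variables (X : T -> R) (U : R) (K : nat).
Hypothesis mX : measurable_fun setT X.
Hypotheses (U0 : 0 < U) (K0 : (0 < K)%N).
Local Notation idx := (@cellidx R U K).
Local Notation int f := (P.-integrable setT (EFin \o f)).

Lemma measurable_preimage (B : set R) : measurable B -> measurable (X @^-1` B).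
Proof. by move=> mB; rewrite -[X in measurable X]setTI; exact: mX. Qed.

Definition cellw (i : 'I_K.+1) : R := fine (P (X @^-1` [set y | idx y = i])).

Lemma cellw_ge0 i : 0 <= cellw i.
Proof. exact/fine_ge0/measure_ge0. Qed.

Lemma cellwE i : P (X @^-1` [set y | idx y = i]) = (cellw i)%:E.
Proof.
rewrite fineK// fin_num_measure//; apply: measurable_preimage.
exact: measurable_cell.
Qed.

Lemma idx_sum (h : 'I_K.+1 -> R) t : (h (idx (X t)))%:E =
  (\sum_i (h i)%:E * (\1_(X @^-1` [set y | idx y = i]) t)%:E)%E.
Proof.
rewrite (bigD1 (idx (X t)))//= big1 ?adde0 => [|i ni].
  by rewrite indicE mem_set// mule1.
by rewrite indicE memNset ?mule0// => /= e; rewrite e eqxx in ni.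
Qed.

Lemma integrable_idx (h : 'I_K.+1 -> R) : int (fun t => h (idx (X t))).
Proof.
rewrite (_ : EFin \o _ = fun t =>
  \sum_i (h i)%:E * (\1_(X @^-1` [set y | idx y = i]) t)%:E)%E; last first.
  by apply/funext => t; exact: idx_sum.
apply: integrable_sum => //= i _; apply: integrableZl => //.
by apply: integrable_indic; apply: measurable_preimage; exact: measurable_cell.
Qed.

Lemma Rintegral_idx (h : 'I_K.+1 -> R) :
  \int[P]_t h (idx (X t)) = \sum_i cellw i * h i.
Proof.
rewrite /Rintegral; under eq_integral do rewrite idx_sum.
rewrite integral_sum//=.
  rewrite -[RHS]/(fine (\sum_i cellw i * h i)%:E) -sumEFin; congr fine.
  apply: eq_bigr => i _; rewrite integralZl//; last first.
    by apply: integrable_indic; apply: measurable_preimage; exact: measurable_cell.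
  rewrite integral_indic//; last by apply: measurable_preimage; exact: measurable_cell.
  rewrite setIT EFinM muleC; congr (_ * _)%E; exact: cellwE.
move=> i; apply: integrableZl => //.
by apply: integrable_indic; apply: measurable_preimage; exact: measurable_cell.
Qed.

Lemma cellw_sum1 : \sum_i cellw i = 1.
Proof.
transitivity (\sum_i cellw i * 1); first by apply: eq_bigr => i _; rewrite mulr1.
rewrite -(Rintegral_idx (fun=> 1)) Rintegral_cst// mul1r.
exact: (congr1 fine (probability_setT P)).
Qed.

Definition celleta : R := \sum_i cellw i * gridpt U K i.

Definition disc_law : finlaw R :=
  FinLaw (fun i : 'I_K.+1 => gridpt U K i - celleta) cellw_ge0 cellw_sum1.

Lemma E1_disc (f : R -> R) :
  E1 disc_law f = \int[P]_t f (roundup U K (X t) - celleta).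
Proof. by rewrite (Rintegral_idx (fun i => f (gridpt U K i - celleta))). Qed.

Lemma integrable_disc (f : R -> R) :
  int (fun t => f (roundup U K (X t) - celleta)).
Proof. exact: (integrable_idx (fun i => f (gridpt U K i - celleta))). Qed.

Lemma disc_mean0 : E1 disc_law id = 0.
Proof.
rewrite /E1 /=; under eq_bigr do rewrite mulrBr.
by rewrite sumrB -mulr_suml cellw_sum1 mul1r subrr.
Qed.

Lemma celletaE : celleta = \int[P]_t roundup U K (X t).
Proof. by rewrite (Rintegral_idx (fun i => gridpt U K i)). Qed.

Lemma integrable_roundup : int (fun t => roundup U K (X t)).
Proof. exact: (integrable_idx (fun i => gridpt U K i)). Qed.

End DiscreteLaw.

Lemma bigsetU_finP (T : Type) (I : finType) (F : I -> set T) :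
  \big[setU/set0]_(i : I) F i = [set t | exists i, F i t].
Proof.
rewrite -bigcup_seq; apply/seteqP; split => t /= [i].
  by move=> _ h; exists i.
by move=> h; exists i => //=; rewrite mem_index_enum.
Qed.

Section JointLaw.
Context d (T : measurableType d) (R : realType) (P : probability T R).
Variables (Y : nat -> T -> R) (U : R) (K : nat).
Hypothesis mY : forall n, (0 < n)%N -> measurable_fun setT (Y n).
Hypothesis indY : iid_indep P Y.
Hypothesis idY : ident_distr P Y.
Hypotheses (U0 : 0 < U) (K0 : (0 < K)%N).
Local Notation L := (disc_law P U K (mY (ltn0Sn 0))).
Local Notation idx := (@cellidx R U K).
Local Notation cellw := (cellw P (Y 1%N) U (K := K)).

Definition idxs (t : T) a n := [seq idx (Y k t) | k <- iota a n].

Let mcell a (i : 'I_K.+1) : (0 < a)%N -> measurable (Y a @^-1` [set y | idx y = i]).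
Proof.
by move=> a0; apply: measurable_preimage; [exact: mY|exact: measurable_cell].
Qed.

Lemma measurable_idxs (B : seq 'I_K.+1 -> bool) a n : (0 < a)%N ->
  measurable [set t | B (idxs t a n)].
Proof.
elim: n a B => [|n IH] a B a0.
  rewrite /idxs /=; case: (B [::]).
    by rewrite (_ : [set _ | _] = setT)//; apply/seteqP; split.
  by rewrite (_ : [set _ | _] = set0)//; apply/seteqP; split => t.
rewrite (_ : [set _ | _] = \big[setU/set0]_(i < K.+1)
  ((Y a @^-1` [set y | idx y = i]) `&` [set t | B (i :: idxs t a.+1 n)])).
  apply: bigsetU_measurable => i _; apply: measurableI; last exact: (IH a.+1 (fun s => B (i :: s))).
  exact: mcell.
rewrite bigsetU_finP; apply/seteqP; split => t /=.
  by move=> h; exists (idx (Y a t)).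
by case=> i [<-].
Qed.

Lemma P_prefix (p : seq 'I_K.+1) :
  P [set t | idxs t 1 (size p) == p] = (\prod_(i <- p) cellw i)%:E.
Proof.
pose B j : set R := [set y | idx y = nth ord0 p j.-1].
have mB j : measurable (B j) by exact: measurable_cell.
have /= := @indY (iota 1 (size p)) B (iota_uniq _ _) _ mB.
rewrite (_ : \bigcap_(_ in _) _ = [set t | idxs t 1 (size p) == p]); last first.
  apply/seteqP; split => t /=.
    move=> h; apply/eqP/(@eq_from_nth _ ord0); rewrite size_map size_iota// => j jp.
    rewrite (nth_map 0%N) ?size_iota// nth_iota// add1n.
    by apply: (h j.+1); rewrite /= mem_iota add1n ltnS.
  move=> /eqP h j /=; rewrite mem_iota add1n => /andP[j0]; rewrite ltnS => jp.
  have jp' : (j.-1 < size p)%N by rewrite prednK.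
  rewrite /B /= -h (nth_map 0%N) ?size_iota// nth_iota// add1n prednK//.
move=> ->; last by apply/allP => j; rewrite mem_iota => /andP[].
have prodE (s : seq nat) (F : nat -> R) :
    (\prod_(j <- s) (F j)%:E)%E = (\prod_(j <- s) F j)%:E.
  by elim: s => [|j s IHs]; rewrite ?big_nil// !big_cons IHs EFinM.
transitivity (\prod_(j <- iota 1 (size p)) (cellw (nth ord0 p j.-1))%:E)%E.
  apply: eq_big_seq => j; rewrite mem_iota => /andP[j0 _].
  rewrite idY//; exact: cellwE (mY (ltn0Sn 0)) _.
by rewrite prodE (big_nth ord0) /index_iota subn0 (iotaDl 1 0) big_map.
Qed.

Definition zpath t a n : seq R :=
  [seq roundup U K (Y k t) - celleta P (Y 1%N) U K | k <- iota a n].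

Lemma zpathE t a n :
  zpath t a n = [seq gridpt U K (i : 'I__) - celleta P (Y 1%N) U K | i <- idxs t a n].
Proof. by rewrite /idxs -map_comp. Qed.

Lemma measurable_zpath (B : seq R -> bool) a n : (0 < a)%N ->
  measurable [set t | B (zpath t a n)].
Proof.
move=> a0; rewrite (_ : [set _ | _] = [set t | B [seq gridpt U K (i : 'I__) -
  celleta P (Y 1%N) U K | i <- idxs t a n]]).
  exact: (@measurable_idxs (fun s => B (map _ s))).
by apply/seteqP; split => t /=; rewrite zpathE.
Qed.

Lemma P_prefix_zpath (p : seq 'I_K.+1) n (A : seq R -> bool) :
  P ([set t | idxs t 1 (size p) == p] `&` [set t | A (zpath t (size p).+1 n)]) =
  (\prod_(i <- p) cellw i * Pr L n A)%:E.
Proof.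
elim: n p A => [|n IH] p A.
  rewrite /Pr /= /zpath /=; case: (A [::]).
    by rewrite (_ : [set _ | true] = setT) ?setIT ?P_prefix ?mulr1//; apply/seteqP; split.
  by rewrite (_ : [set _ | false] = set0) ?setI0 ?measure0 ?mulr0//; apply/seteqP; split.
pose z (i : 'I_K.+1) := gridpt U K i - celleta P (Y 1%N) U K.
pose F (i : 'I_K.+1) := [set t | idxs t 1 (size (rcons p i)) == rcons p i] `&`
  [set t | A (z i :: zpath t (size (rcons p i)).+1 n)].
have sp i : size (rcons p i) = (size p).+1 by rewrite size_rcons.
have idxsS t : idxs t 1 (size p).+1 = rcons (idxs t 1 (size p)) (idx (Y (size p).+1 t)).
  by rewrite /idxs -[(size p).+1 in LHS]addn1 iotaD map_cat /= cats1 add1n.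
have -> : [set t | idxs t 1 (size p) == p] `&` [set t | A (zpath t (size p).+1 n.+1)] =
    \big[setU/set0]_i F i.
  rewrite bigsetU_finP; apply/seteqP; split => t /=.
    move=> [/eqP h1 h2]; exists (idx (Y (size p).+1 t)); split=> /=.
      by rewrite sp idxsS h1.
    by rewrite sp.
  case=> i [] /=; rewrite sp idxsS eqseq_rcons => /andP[h1 /eqP h2] h3; split=> //.
  by rewrite /zpath /= /roundup h2.
rewrite measure_bigsetU_ord; last first.
- apply/trivIsetP => i j _ _ ij; apply/seteqP; split => t // [[/= e1 _] [/= e2 _]].
  move: e1 e2; rewrite !sp !idxsS !eqseq_rcons => /andP[_ /eqP h1] /andP[_ /eqP h2].
  by move: ij; rewrite -h1 -h2 eqxx.
- move=> i; apply: measurableI; first exact: (@measurable_idxs (fun s => s == _)).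
  exact: (@measurable_zpath (fun s => A (z i :: s))).
rewrite /Pr /= /E1 mulr_sumr -sumEFin; apply: eq_bigr => i _.
by rewrite (IH (rcons p i) (fun s => A (z i :: s))) big_rcons/= mulrA [_ * cellw i]mulrC.
Qed.

Lemma P_zpath n (A : seq R -> bool) :
  P [set t | A (zpath t 1 n)] = (Pr L n A)%:E.
Proof.
have := P_prefix_zpath [::] n A; rewrite big_nil mul1r => <-; congr (P _).
by apply/seteqP; split => t //= [].
Qed.

End JointLaw.

Lemma roundup_big (R : realType) (U : R) (K : nat) (y : R) :
  0 < U -> (0 < K)%N -> U < y -> roundup U K y = U.
Proof.
move=> U0 K0 Uy; rewrite /roundup cellidxE /cellnum hasNfind ?size_iota ?gridptK//.
apply/hasPn => i; rewrite mem_iota add0n => /andP[_ iK]; rewrite -ltNge.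
apply: le_lt_trans Uy; rewrite -[leRHS](gridptK U K0) lerD2l ler_wpM2r//.
  by rewrite divr_ge0 ?mulr_ge0// ltW.
by rewrite ler_nat ltnW.
Qed.

Section Bridge.
Context d (T : measurableType d) (R : realType) (P : probability T R).
Variables (Y : nat -> T -> R) (lam al a : R).
Hypothesis mY : forall n, (0 < n)%N -> measurable_fun setT (Y n).
Hypothesis indY : iid_indep P Y.
Hypothesis idY : ident_distr P Y.
Local Notation int f := (P.-integrable setT (EFin \o f)).
Hypothesis intY : int (Y 1%N).
Hypothesis meanY : \int[P]_t Y 1%N t = 0.
Hypotheses (lam0 : 0 < lam) (al0 : 0 < al) (a0 : 0 < a).
Hypothesis expY : int (fun t => expR (lam * `|Y 1%N t| `^ al)).
Hypothesis posY : (0 < P (Y 1%N @^-1` [set y | a <= y]%R))%E.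

Let m1 : measurable_fun setT (Y 1%N) := mY (ltn0Sn 0).
Let W : R := \int[P]_t expR (lam * `|Y 1%N t| `^ al).
Let W0 : 0 <= W. Proof. by apply: Rintegral_ge0 => t _; exact: expR_ge0. Qed.

Lemma integrable_cst_prob (k : R) : int (fun=> k).
Proof. exact: finite_measure_integrable_cst. Qed.

Lemma Rintegral_cst_prob (k : R) : \int[P]_t k = k.
Proof.
rewrite Rintegral_cst// -[RHS]mulr1; congr (_ * _).
exact: (congr1 fine (probability_setT P)).
Qed.

Lemma Rintegral_indic_prob (A : set T) : measurable A ->
  \int[P]_t (\1_A t : R) = fine (P A).
Proof. by move=> mA; rewrite /Rintegral integral_indic// setIT. Qed.

Lemma integrableZl_R (k : R) f : int f -> int (fun t => k * f t).
Proof. by move=> h; exact: (integrableZl measurableT k h). Qed.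

Lemma integrableD_R f g : int f -> int g -> int (fun t => f t + g t).
Proof. by move=> hf hg; exact: (integrableD measurableT hf hg). Qed.

Lemma integrableB_R f g : int f -> int g -> int (fun t => f t - g t).
Proof. by move=> hf hg; exact: (integrableB measurableT hf hg). Qed.

Definition ypath t n : seq R := [seq Y k t | k <- iota 1 n].

Lemma measurable_ge (b : R) : measurable [set y : R | b <= y].
Proof. by rewrite -set_itvcy; exact: measurable_itv. Qed.

Lemma measurable_norm_gt (b : R) : measurable [set y : R | b < `|y|].
Proof.
have := @normr_measurable R setT measurableT _ (measurable_itv `]b, +oo[).
rewrite setTI; congr measurable; apply/seteqP.
by split => y /=; rewrite in_itv/= andbT.
Qed.

Definition disc_v : R := (a / 2) ^+ 2 * fine (P (Y 1%N @^-1` [set y | a <= y]%R)).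

Lemma disc_v_gt0 : 0 < disc_v.
Proof using a0 posY mY.
rewrite mulr_gt0 ?exprn_gt0 ?divr_gt0//; apply: fine_gt0; rewrite posY/=.
rewrite ltey_eq fin_num_measure//; apply: measurable_preimage => //.
exact: measurable_ge.
Qed.

Section FixN.
Variables (K2 : R) (N : nat).
Hypotheses (K20 : 0 < K2) (N0 : (0 < N)%N).
Hypothesis sqY : forall y : R, y ^+ 2 <= K2 * expR (lam * `|y| `^ al).

Definition bigU : R := 4 * (K2 * W + 1) * N%:R.
Definition bigK : nat := (Num.truncn (4 * bigU * N%:R)).+1.
Local Notation U := bigU.
Local Notation K := bigK.
Local Notation eta := (celleta P (Y 1%N) U K).
Local Notation L := (disc_law P U K m1).
Local Notation phi := (roundup U K).

Let N0R : 0 < N%:R :> R. Proof. by rewrite ltr0n. Qed.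
Let N1R : 1 <= N%:R :> R. Proof. by rewrite ler1n. Qed.
Let KW : 0 <= K2 * W. Proof. by rewrite mulr_ge0// ltW. Qed.
Let KW1 : 0 < K2 * W + 1. Proof. by rewrite ltr_wpDl. Qed.

Lemma bigU_gt0 : 0 < U.
Proof. by rewrite !mulr_gt0. Qed.
Let U0 := bigU_gt0.
Let K0 : (0 < K)%N. Proof. by []. Qed.

Lemma bigU_ge : N%:R <= U.
Proof.
rewrite /U ler_peMl// ; have := KW; lra.
Qed.

Lemma mesh_small : mesh U K <= (2 * N%:R)^-1.
Proof.
rewrite /mesh ler_pdivrMr ?ltr0n// [leRHS]mulrC ler_pdivlMr ?mulr_gt0//.
apply: le_trans (ltW (truncnS_gt _)).
by have -> : 2 * U * (2 * N%:R) = 4 * U * N%:R by ring.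
Qed.

Lemma eta_small : `|eta| <= N%:R^-1.
Proof.
have ir := integrable_roundup P U K m1.
have -> : eta = \int[P]_t (phi (Y 1%N t) - Y 1%N t).
  by rewrite RintegralB// meanY subr0 (celletaE P U K m1).
apply: le_trans (le_normr_Rintegral measurableT (integrableB_R ir intY)) _.
have iexp := integrableZl_R (2 / U * K2) expY.
apply: le_trans (_ : \int[P]_t (mesh U K + 2 / U * K2 * expR (lam * `|Y 1%N t| `^ al)) <= _).
  apply: le_Rintegral => //.
  - exact: (integrable_abse (integrableB_R ir intY)).
  - by apply: integrableD_R => //; exact: integrable_cst_prob.
  move=> t _; apply: le_trans (roundup_dist U0 K0 _) _; rewrite lerD2l -[leRHS]mulrA.
  by rewrite ler_wpM2l ?divr_ge0 ?(ltW U0).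
rewrite RintegralD//; last exact: integrable_cst_prob.
rewrite Rintegral_cst_prob RintegralZl// -/W.
have -> : N%:R^-1 = (2 * N%:R)^-1 + (2 * N%:R)^-1 :> R.
  by field; rewrite gt_eqF.
apply: lerD; first exact: mesh_small.
have -> : 2 / U * K2 * W = (K2 * W) / (K2 * W + 1) * (2 * N%:R)^-1.
  by rewrite /U; field; rewrite !gt_eqF.
rewrite ler_piMl ?invr_ge0 ?mulr_ge0// ler_pdivrMr// mul1r lerDl//.
Qed.

Lemma dist_small y : `|phi y - eta| <= `|y| + 2.
Proof.
apply: le_trans (ler_normB _ _) _.
have h1 := roundup_norm_le U0 K0 y; have h2 := eta_small; have h3 := mesh_small.
have h4 : N%:R^-1 <= 1 :> R by rewrite invf_le1.
have h5 : (2 * N%:R)^-1 <= 1 :> R by rewrite invf_le1 ?mulr_gt0//; have := N1R; lra.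
by lra.
Qed.

Definition disc_lam : R := lam / 2 `^ al.
Definition disc_B : R := expR (disc_lam * 4 `^ al) + W.

Lemma disc_exp_moment : E1 L (fun y => expR (disc_lam * `|y| `^ al)) <= disc_B.
Proof.
have l0 : 0 < disc_lam by rewrite divr_gt0// powR_gt0.
have -> : disc_B = \int[P]_t (expR (disc_lam * 4 `^ al) + expR (lam * `|Y 1%N t| `^ al)).
  by rewrite (RintegralD measurableT (integrable_cst_prob _) expY) Rintegral_cst_prob.
rewrite E1_disc; apply: (le_Rintegral measurableT
  (integrable_disc P U K m1 (fun y => expR (disc_lam * `|y| `^ al)))
  (integrableD_R (integrable_cst_prob _) expY)).
move=> t _; have h := dist_small (Y 1%N t).
have mono (p q : R) : 0 <= p -> p <= q -> expR (disc_lam * p `^ al) <= expR (disc_lam * q `^ al).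
  move=> p0 pq; rewrite ler_expR ler_pM2l//; apply: ge0_ler_powR => //; first exact: ltW.
  by rewrite nnegrE (le_trans p0).
have [y2|y2] := leP `|Y 1%N t| 2.
  apply: le_trans (_ : expR (disc_lam * 4 `^ al) <= _); last by rewrite lerDl expR_ge0.
  by apply: mono => //; lra.
apply: le_trans (_ : expR (lam * `|Y 1%N t| `^ al) <= _); last by rewrite lerDr expR_ge0.
have -> : lam * `|Y 1%N t| `^ al = disc_lam * (2 * `|Y 1%N t|) `^ al.
  rewrite powRM// /disc_lam; field; rewrite gt_eqF// powR_gt0//.
by apply: mono => //; lra.
Qed.

Lemma disc_var : 2 / a <= N%:R -> a <= N%:R -> disc_v <= E1 L (fun y => y ^+ 2).
Proof.
rewrite ler_pdivrMr// => Na aN.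
have mA : measurable (Y 1%N @^-1` [set y | a <= y]%R).
  by apply: measurable_preimage => //; exact: measurable_ge.
rewrite E1_disc /disc_v -Rintegral_indic_prob// -RintegralZl//; last exact: integrable_indic.
apply: le_Rintegral => //.
- by apply: integrableZl_R; exact: integrable_indic.
- exact: (integrable_disc P U K m1 (fun y => y ^+ 2)).
move=> t _; rewrite indicE; case: (boolP (t \in _)) => [|_]; last by rewrite mulr0 sqr_ge0.
rewrite inE /= => aY; rewrite mulr1.
have ea : `|eta| <= a / 2.
  apply: le_trans eta_small _; rewrite -[N%:R^-1]mul1r ler_pdivrMr//.
  by move: Na; rewrite mulrC; lra.
have pa : a <= phi (Y 1%N t).
  have [yU|yU] := leP (Y 1%N t) U; first exact: le_trans aY (roundup_ge K0 yU).
  by rewrite roundup_big// (le_trans aN)// bigU_ge.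
have : a / 2 <= phi (Y 1%N t) - eta.
  by move: ea; rewrite ler_norml => /andP[_ ea]; move: (phi _) pa => p pa; lra.
move: (phi _ - eta) => p ap; have a2 : 0 <= a / 2 by rewrite divr_ge0// ltW.
by rewrite ler_pXn2r ?nnegrE// (le_trans a2 ap).
Qed.

Lemma prob_bad : fine (P [set t | exists2 k, (0 < k <= N)%N & U < `|Y k t|]) <= N%:R^-1.
Proof.
have mB k : (0 < k)%N -> measurable (Y k @^-1` [set y | U < `|y|]%R).
  by move=> k0; apply: measurable_preimage; [exact: mY|exact: measurable_norm_gt].
pose q := fine (P (Y 1%N @^-1` [set y | U < `|y|]%R)).
have qE : P (Y 1%N @^-1` [set y | U < `|y|]%R) = q%:E.
  by rewrite fineK// fin_num_measure//; exact: mB.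
have q_le : q <= K2 / U ^+ 2 * W.
  rewrite /q -Rintegral_indic_prob; last exact: mB.
  rewrite -RintegralZl//; apply: le_Rintegral => //.
  - by apply: integrable_indic; exact: mB.
  - exact: integrableZl_R.
  move=> t _; rewrite indicE; case: (boolP (t \in _)) => [|_]; last first.
    by rewrite mulr_ge0 ?expR_ge0// divr_ge0 ?sqr_ge0// ltW.
  rewrite inE /= => UY; rewrite mulrAC ler_pdivlMr ?exprn_gt0// mul1r.
  apply: le_trans (sqY _); rewrite -[leRHS]real_normK ?num_real//.
  by rewrite ler_pXn2r ?nnegrE ?(ltW U0)// ltW.
have -> : [set t | exists2 k, (0 < k <= N)%N & U < `|Y k t|] =
    \big[setU/set0]_(k < N) (Y k.+1 @^-1` [set y | U < `|y|]%R).
  rewrite bigsetU_finP; apply/seteqP; split => t /=.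
    by move=> [[|k]// kN h]; exists (Ordinal (kN : (k < N)%N)).
  by move=> [k h]; exists k.+1 => //=; exact: ltn_ord.
have h : (P (\big[setU/set0]_(k < N) (Y k.+1 @^-1` [set y | U < `|y|]%R)) <= (N%:R * q)%:E)%E.
  have := @Boole_inequality _ _ _ P (fun k => Y k.+1 @^-1` [set y | U < `|y|]%R) N
    (fun i _ => mB i.+1 (ltn0Sn i)).
  move=> /le_trans; apply.
  rewrite (eq_bigr (fun=> q%:E)) => [|k _]; last first.
    rewrite -qE; apply: idY => //; exact: measurable_norm_gt.
  by rewrite sumEFin sumr_const card_ord mulr_natl.
apply: le_trans (_ : N%:R * q <= _).
  rewrite -[leRHS]/(fine (N%:R * q)%:E); apply: fine_le => //.
  rewrite fin_num_measure//; apply: bigsetU_measurable => k _; exact: mB.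
apply: le_trans (ler_wpM2l (ler0n _ _) q_le) _.
have -> : N%:R * (K2 / U ^+ 2 * W) =
    (K2 * W) / (K2 * W + 1) * (16 * (K2 * W + 1))^-1 * N%:R^-1.
  by rewrite /U; field; rewrite !gt_eqF.
rewrite ler_piMl ?invr_ge0//; apply: mulr_ile1.
- by rewrite divr_ge0// ltW.
- by rewrite invr_ge0 mulr_ge0// ltW.
- by rewrite ler_pdivrMr// mul1r lerDl.
by rewrite invf_le1 ?mulr_gt0//; have := KW; lra.
Qed.

Definition good t := forall k, (0 < k <= N)%N -> `|Y k t| <= U.

Lemma good_paths t i : good t -> (i < N)%N ->
  (ypath t N)`_i <= (zpath P Y U K t 1 N)`_i + eta <= (ypath t N)`_i + N%:R^-1.
Proof.
move=> g iN; rewrite !(nth_map 0%N) ?size_iota// nth_iota// add1n subrK.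
have := g i.+1 iN; rewrite ler_norml => /andP[h1 h2].
rewrite (roundup_ge K0 h2)/=; apply: le_trans (roundup_le U0 K0 h1) _.
rewrite lerD2l; apply: le_trans mesh_small _.
by rewrite lef_pV2 ?posrE ?mulr_gt0//; have := N0R; lra.
Qed.

Definition coupled (y z : seq R) := [/\ size y = N, size z = N &
  forall i, (i < N)%N -> y`_i <= z`_i + eta <= y`_i + N%:R^-1].

Lemma good_coupled t : good t -> coupled (ypath t N) (zpath P Y U K t 1 N).
Proof.
by move=> g; split; rewrite ?size_map ?size_iota// => i; exact: good_paths.
Qed.

Let Bad : set T := [set t | exists2 k, (0 < k <= N)%N & U < `|Y k t|].

Lemma notBad_good t : ~ Bad t -> good t.
Proof.
by move=> h k kN; rewrite leNgt; apply/negP => Uk; apply: h; exists k.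
Qed.

Let mBad : measurable Bad.
Proof.
rewrite (_ : Bad = \big[setU/set0]_(k < N) (Y k.+1 @^-1` [set y | U < `|y|]%R)).
  apply: bigsetU_measurable => k _; apply: measurable_preimage; first exact: mY.
  exact: measurable_norm_gt.
rewrite bigsetU_finP; apply/seteqP; split => t /=.
  by move=> [[|k]// kN h]; exists (Ordinal (kN : (k < N)%N)).
by move=> [k h]; exists k.+1 => //=; exact: ltn_ord.
Qed.

Lemma fine_P_le_add (A1 A2 : set T) : measurable A1 -> measurable A2 ->
  A1 `<=` A2 `|` Bad -> fine (P A1) <= fine (P A2) + N%:R^-1.
Proof.
move=> mA1 mA2 sub.
have fin (A : set T) : measurable A -> P A \is a fin_num by move=> ?; exact: fin_num_measure.
apply: le_trans (_ : fine (P A2) + fine (P Bad) <= _); last first.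
  by rewrite lerD2l; exact: prob_bad.
rewrite -fineD ?fin//; apply: fine_le; rewrite ?fin_numD ?fin//.
apply: le_trans (measureU2 _ mA2 mBad); apply: le_measure; rewrite ?inE//.
exact: measurableU.
Qed.

Lemma coupling_upper (A A' : seq R -> bool) : measurable [set t | A (ypath t N)] ->
  (forall y z, coupled y z -> A y -> A' z) ->
  fine (P [set t | A (ypath t N)]) <= Pr L N A' + N%:R^-1.
Proof.
move=> mA h; rewrite -[Pr L N A']/(fine (Pr L N A')%:E).
rewrite -(P_zpath U K mY indY idY).
apply: fine_P_le_add => //; first exact: measurable_zpath.
move=> t /= At; have [|nB] := pselect (Bad t); first by right.
by left => /=; apply: h At; exact/good_coupled/notBad_good.
Qed.

Lemma coupling_lower (A A' : seq R -> bool) : measurable [set t | A (ypath t N)] ->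
  (forall y z, coupled y z -> A' z -> A y) ->
  Pr L N A' <= fine (P [set t | A (ypath t N)]) + N%:R^-1.
Proof.
move=> mA h; rewrite -[Pr L N A']/(fine (Pr L N A')%:E).
rewrite -(P_zpath U K mY indY idY).
apply: fine_P_le_add => //; first exact: measurable_zpath.
move=> t /= At; have [|nB] := pselect (Bad t); first by right.
by left => /=; apply: h At; exact/good_coupled/notBad_good.
Qed.

Lemma disc_bounded (M : R) : {ae P, forall t, `|Y 1%N t| <= M} -> forall f : R -> R,
  (forall y, 0 <= f y) -> (forall y, `|y| <= M + 2 -> f y = 0) -> E1 L f = 0.
Proof.
move=> aeM f f0 fM; rewrite E1_disc /Rintegral.
rewrite (@ae_eq_integral _ _ _ P setT (cst 0%E))//.
- by rewrite integral0.
- by have /integrableP[] := integrable_disc P U K m1 f.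
- apply: filterS aeM => t /= h _; congr EFin; apply: fM.
  by apply: le_trans (dist_small _) _; rewrite lerD2r.
Qed.

End FixN.
End Bridge.

(** * Transfer to the original process *)

Section Core.
Context d (T : measurableType d) (R : realType) (P : probability T R).
Variables (Y : nat -> T -> R) (lam al a : R).
Hypothesis mY : forall n, (0 < n)%N -> measurable_fun setT (Y n).
Hypothesis indY : iid_indep P Y.
Hypothesis idY : ident_distr P Y.
Hypothesis intY : P.-integrable setT (EFin \o Y 1%N).
Hypothesis meanY : \int[P]_t Y 1%N t = 0.
Hypotheses (lam0 : 0 < lam) (al0 : 0 < al) (a0 : 0 < a).
Hypothesis expY : P.-integrable setT (EFin \o (fun t => expR (lam * `|Y 1%N t| `^ al))).
Hypothesis posY : (0 < P (Y 1%N @^-1` [set y | a <= y]%R))%E.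
Variables (C : nat -> R) (D : R).
Hypothesis CD : forall n, \sum_(0 <= j < n) `|C j - 1| <= D.

Definition pbelow x N := fine (P [set t | below C x (ypath Y t N)]).

Lemma measurable_below x N : measurable [set t | below C x (ypath Y t N)].
Proof.
rewrite (_ : [set _ | _] = \bigcap_(n in `I_N) [set t | conv C (ypath Y t N) n.+1 <= x]).
  apply: fin_bigcap_measurable => // n _.
  have mc : measurable_fun setT (fun t => conv C (ypath Y t N) n.+1).
    apply: measurable_sum => i; apply: measurable_funM => //.
    have [iN|iN] := ltnP i N.
      rewrite (_ : (fun _ => _) = Y i.+1); first exact: mY.
      by apply/funext => t; rewrite (nth_map 0%N) ?size_iota// nth_iota// add1n.
    rewrite (_ : (fun _ => _) = cst 0)//.
    by apply/funext => t; rewrite nth_default// size_map size_iota.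
  have := mc measurableT _ (measurable_itv `]-oo, x]).
  by rewrite setTI; congr measurable; apply/seteqP; split => t /=; rewrite in_itv.
apply/seteqP; split => t /=.
  by move=> /belowP h n /= nN; apply: h; rewrite size_map size_iota.
by move=> h; apply/belowP => n; rewrite size_map size_iota => nN; exact: h.
Qed.

Lemma pbelow_le x x' N : x <= x' -> pbelow x N <= pbelow x' N.
Proof.
move=> xx; have fin y : P [set t | below C y (ypath Y t N)] \is a fin_num.
  by apply: fin_num_measure; exact: measurable_below.
apply: fine_le => //; apply: le_measure; rewrite ?inE; [exact: measurable_below..|].
move=> t /= /belowP h; apply/belowP => n hn; exact: le_trans (h n hn) xx.
Qed.

Lemma conv_diff (N n : nat) (eta : R) (y z : seq R) : (0 < N)%N -> (n <= N)%N ->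
  `|eta| <= N%:R^-1 ->
  (forall i, (i < N)%N -> y`_i <= z`_i + eta <= y`_i + N%:R^-1) ->
  `|conv C z n - conv C y n| <= 2 * (1 + D).
Proof.
move=> N0 nN he hyz; have N0R : 0 < N%:R :> R by rewrite ltr0n.
rewrite /conv -sumrB; apply: le_trans (ler_norm_sum _ _ _) _.
have D1 : 0 <= 1 + D by rewrite addr_ge0// (D_ge0 CD).
apply: le_trans (_ : \sum_(0 <= i < n) (1 + D) * (2 / N%:R) <= _).
  apply: ler_sum_nat => i /andP[_ ni]; rewrite -mulrBr normrM; apply: ler_pM => //.
    exact: (normC_le CD).
  have := hyz i (leq_trans ni nN) => /andP[h1 h2].
  by move: he; rewrite !ler_norml => /andP[h3 h4]; apply/andP; split; lra.
rewrite sumr_const_nat subn0.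
have -> : (1 + D) * (2 / N%:R) *+ n = n%:R / N%:R * (2 * (1 + D)).
  by rewrite -[LHS]mulr_natl; field; rewrite gt_eqF.
by rewrite ler_piMl ?mulr_ge0// ler_pdivrMr// mul1r ler_nat.
Qed.

Definition discrete_model (lam1 B v : R) N (L : finlaw R) (eta : R) : Prop :=
  [/\ exp_class lam1 al B v L, N%:R * `|eta| <= 1,
      (forall x, pbelow x N <= Pr L N (below C (x + 2 * (1 + D))) + N%:R^-1) /\
      (forall x, Pr L N (below C x) <= pbelow (x + 2 * (1 + D)) N + N%:R^-1),
      ((forall j, 0 <= C j) -> forall x, qfin C L eta x N <= pbelow x N + N%:R^-1) &
      forall M, {ae P, forall t, `|Y 1%N t| <= M} ->
        E1 L (fun y => (M + 2 < `|y|)%R%:R) = 0 /\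
        E1 L (fun y => Num.max (y - (M + 2)) 0) = 0].

Lemma discretisation : exists lam1 B v : R, [/\ 0 < lam1, 0 < v &
  \forall N \near \oo, exists L eta, discrete_model lam1 B v N L eta].
Proof.
have [K2 K20 hK2] := exprn_le_expR 2 lam0 al0.
have sqY y : y ^+ 2 <= K2 * expR (lam * `|y| `^ al).
  by rewrite -[y ^+ 2]real_normK ?num_real//; exact: hK2.
exists (disc_lam lam al), (disc_B P Y lam al), (disc_v P Y a); split.
- by rewrite divr_gt0// powR_gt0.
- exact: (disc_v_gt0 mY).
near=> N.
have N0 : (0 < N)%N by near: N; exists 1%N.
have N0R : 0 < N%:R :> R by rewrite ltr0n.
pose U := bigU P Y lam al K2 N; pose K := bigK P Y lam al K2 N.
pose eta := celleta P (Y 1%N) U K.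
exists (disc_law P U K (mY (ltn0Sn 0))), eta.
have he : `|eta| <= N%:R^-1 by exact: eta_small.
have cd x n y z : coupled P Y lam al K2 N y z -> (n < N)%N ->
    (conv C y n.+1 <= x -> conv C z n.+1 <= x + 2 * (1 + D)) /\
    (conv C z n.+1 <= x -> conv C y n.+1 <= x + 2 * (1 + D)).
  move=> [sy sz h] nN; have := conv_diff N0 nN he h.
  by rewrite ler_norml => /andP[h1 h2]; split => h3; lra.
split.
- split; [exact: disc_mean0| |exact: disc_exp_moment].
  by apply: disc_var => //; near: N; exact: nbhs_infty_ger.
- by rewrite mulrC -ler_pdivlMr// mul1r.
- split=> x.
    apply: (@coupling_upper _ _ _ _ _ _ _ mY indY idY expY K2 N K20 N0 sqY (below C x)).
      exact: measurable_below.
    move=> y z c /belowP h; have [sy sz _] := c; apply/belowP => n; rewrite sz => nN.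
    by have [+ _] := cd x n y z c nN; apply; apply: h; rewrite sy.
  apply: (@coupling_lower _ _ _ _ _ _ _ mY indY idY expY K2 N K20 N0 sqY
    (below C (x + 2 * (1 + D)))).
    exact: measurable_below.
  move=> y z c /belowP h; have [sy sz _] := c; apply/belowP => n; rewrite sy => nN.
  by have [_ +] := cd x n y z c nN; apply; apply: h; rewrite sz.
- move=> C0 x.
  apply: (@coupling_lower _ _ _ _ _ _ _ mY indY idY expY K2 N K20 N0 sqY (below C x)).
    exact: measurable_below.
  move=> y z [sy sz hc] /belowP h; apply/belowP => n; rewrite sy => nN.
  apply: le_trans (h n _); last by rewrite size_map sz.
  apply: conv_le => // i; have [iN|iN] := ltnP i N.
    by rewrite (nth_map 0) ?sz//; have /andP[] := hc i iN.
  by rewrite !nth_default// ?size_map ?sz ?sy.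
- move=> M aeM.
  split; apply: (disc_bounded mY intY meanY expY K20 N0 sqY aeM) => y.
  + exact: ler0n.
  + by move=> yM; rewrite ltNge yM.
  + by rewrite le_max lexx orbT.
  + by move=> yM; rewrite max_r// subr_le0 (le_trans (ler_norm _)).
Unshelve. all: by end_near. Qed.

Lemma inv_le_sqrt (N : nat) : (0 < N)%N -> N%:R^-1 <= (Num.sqrt N%:R)^-1 :> R.
Proof.
move=> N0; have s1 := @sqrt_ge1 R _ N0; have s0 : 0 < Num.sqrt N%:R :> R by lra.
rewrite lef_pV2 ?posrE ?ltr0n//.
by rewrite -[leRHS]sqr_sqrtr ?ler0n// expr2 ler_peMl// ltW.
Qed.

Lemma core_upper x : 0 <= x ->
  precsim (pbelow x) (fun N => N%:R `^ (- 2^-1) * ln N%:R `^ al^-1).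
Proof.
move=> x0; have [lam1 [B [v [l0 v0 hd]]]] := discretisation.
have x'0 : 0 <= x + 2 * (1 + D).
  by rewrite addr_ge0// mulr_ge0// addr_ge0// (D_ge0 CD).
have [K hK] := fin_upper B l0 al0 v0 CD x'0.
exists (K + 1); near=> N.
have N0 : (0 < N)%N by near: N; exists 1%N.
have l1 : 1 <= ln N%:R :> R by near: N; exact: ln_ge1_near.
have [L [eta [LC _ [h _] _ _]]] : exists L eta, discrete_model lam1 B v N L eta by near: N.
have hK' : forall L, exp_class lam1 al B v L -> Pr L N (below C (x + 2 * (1 + D))) <=
  K * (N%:R `^ (- 2^-1) * ln N%:R `^ al^-1) by near: N.
apply: le_trans (h x) _; rewrite [leRHS]mulrDl mul1r; apply: lerD; first exact: hK'.
apply: le_trans (inv_le_sqrt N0) _; rewrite -powRNhalf ler_peMr ?powR_ge0//.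
by rewrite -[leLHS](powRr0 (ln N%:R)) ler_powR// invr_ge0 ltW.
Unshelve. all: by end_near. Qed.

Lemma core_lower x ep : (forall j, 0 <= C j) -> 0 <= x -> 0 < ep ->
  \forall N \near \oo,
    N%:R `^ (- 2^-1) * ln N%:R `^ (- al^-1 - ep) <= pbelow x N.
Proof.
move=> C0 x0 ep0; have [lam1 [B [v [l0 v0 hd]]]] := discretisation.
have hl := fin_lower B l0 al0 v0 CD C0 x0 ep0.
have half0 : 0 < 2^-1 :> R by rewrite invr_gt0.
near=> N.
have N0 : (0 < N)%N by near: N; exists 1%N.
have l1 : 1 <= ln N%:R :> R by near: N; exact: ln_ge1_near.
have [L [eta [LC he _ h _]]] : exists L eta, discrete_model lam1 B v N L eta by near: N.
have hl' : forall L eta, exp_class lam1 al B v L -> N%:R * `|eta| <= 1 ->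
  2 * (N%:R `^ (- 2^-1) * ln N%:R `^ (- al^-1 - ep)) <= qfin C L eta x N by near: N.
have h1 := hl' L eta LC he; have h2 := h C0 x.
suff h3 : N%:R^-1 <= N%:R `^ (- 2^-1) * ln N%:R `^ (- al^-1 - ep).
  by move: (N%:R `^ _ * _) h1 h3 => w h1 h3; lra.
have s1 := @sqrt_ge1 R _ N0; have s0 : 0 < Num.sqrt N%:R :> R by lra.
have pl : 1 * ln N%:R `^ (al^-1 + ep) <= N%:R `^ 2^-1.
  by near: N; exact: (near_infty_natr (polylog_le _ _ half0)).
rewrite mul1r powR12_sqrt ?ler0n// in pl.
rewrite powRNhalf -opprD powRN -invfM.
have z0 : 0 < ln N%:R `^ (al^-1 + ep) by rewrite powR_gt0//; lra.
rewrite lef_pV2 ?posrE ?ltr0n// ?mulr_gt0//.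
by rewrite -[leRHS]sqr_sqrtr ?ler0n// expr2 ler_pM2l.
Unshelve. all: by end_near. Qed.

Lemma core_bounded (M : R) : {ae P, forall t, `|Y 1%N t| <= M} ->
  exists x0 : R, 0 <= x0 /\ forall x, x0 <= x ->
    asymp (pbelow x) (fun N => N%:R `^ (- 2^-1)).
Proof.
move=> aeM'; pose M1 := `|M|.
have aeM : {ae P, forall t, `|Y 1%N t| <= M1}.
  by apply: filterS aeM' => t /le_trans; apply; exact: ler_norm.
have M10 : 0 <= M1 by exact: normr_ge0.
have D0 := D_ge0 CD.
have [lam1 [B [v [l0 v0 hd]]]] := discretisation.
have [M4 M40 hM4] := exp_class_m4 B v l0 al0.
have c0 := negc_gt0 v0 M40; have a1 := alivec_gt0 v0 M40.
have upp := alive_upper v0 M40; have low := alive_lower v0 M40.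
move: (negc v M4) (alivec v M4) c0 a1 upp low => c ac c0 a1 upp low.
pose u := M1 + 2; have u0 : 0 <= u by rewrite /u; lra.
pose b := u + 1; have b0 : 0 < b by rewrite /b; lra.
have Du0 : 0 <= D * u by rewrite mulr_ge0.
pose x0 := b + D * u + 2 * (1 + D).
exists x0; split; first by rewrite /x0; lra.
move=> x x0x; have xx0 : 0 <= x by apply: le_trans x0x; rewrite /x0; lra.
split.
  exists ((2 * (x + 2 * (1 + D) + D * u) + u + 1) / c + 1); near=> N.
  have N0 : (0 < N)%N by near: N; exists 1%N.
  have [L [eta [LC he [h _] _ hb]]] : exists L eta, discrete_model lam1 B v N L eta by near: N.
  have [b1 b2] := hb M1 aeM; have [mean0 vL LB] := LC.
  have s1 := @sqrt_ge1 R _ N0; have s0 : 0 < Num.sqrt N%:R :> R by lra.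
  rewrite powRNhalf [leRHS]mulrDl mul1r; apply: le_trans (h x) _.
  apply: lerD (inv_le_sqrt N0); apply: le_trans (Pr_below_le CD L N _ u0) _.
  rewrite b1 mulr0 addr0.
  have bb : 0 <= x + 2 * (1 + D) + D * u by lra.
  have := upp L mean0 vL (hM4 _ LC) N _ u bb u0; rewrite b2 mulr0 => /(_ ler01) hu.
  by rewrite -mulrA -invfM ler_pdivlMr ?mulr_gt0// mulrC.
exists (2 / (ac * b)); near=> N.
have N0 : (0 < N)%N by near: N; exists 1%N.
have [L [eta [LC he [_ h] _ hb]]] : exists L eta, discrete_model lam1 B v N L eta by near: N.
have [b1 b2] := hb M1 aeM; have [mean0 vL LB] := LC.
have s1 := @sqrt_ge1 R _ N0; have s0 : 0 < Num.sqrt N%:R :> R by lra.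
have NN (q : R) : 0 <= q -> q ^+ 2 <= N%:R -> q <= Num.sqrt N%:R.
  by move=> q0 qN; rewrite -[leLHS]ger0_norm// -sqrtr_sqr ler_wsqrtr.
have bN : b <= Num.sqrt N%:R.
  by apply: NN; [exact: ltW|near: N; exact: nbhs_infty_ger].
have ab0 : 0 < ac * b by rewrite mulr_gt0.
have abN : 2 / (ac * b) <= Num.sqrt N%:R.
  by apply: NN; [rewrite divr_ge0// ltW|near: N; exact: nbhs_infty_ger].
have ub : u + 1 <= b by [].
have := low L mean0 vL (hM4 _ LC) N b u N0 u0 ub bN; rewrite b2 mulr0 => /(_ ler01) hlow.
have h1 : Pr L N (alive b 0) <= Pr L N (below C (b + D * u)).
  by apply: le_trans (Pr_alive_le CD L N b u0) _; rewrite b1 mulr0 addr0.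
have h2 : pbelow x0 N <= pbelow x N by exact: pbelow_le.
have h3 := h (b + D * u); rewrite -/x0 in h3.
have h4 : ac * b <= Num.sqrt N%:R * (pbelow x N + N%:R^-1).
  by apply: le_trans hlow _; rewrite ler_pM2l//; lra.
have h5 : Num.sqrt N%:R * N%:R^-1 <= ac * b / 2.
  have -> : Num.sqrt N%:R * N%:R^-1 = (Num.sqrt N%:R)^-1 :> R.
    rewrite -[X in X^-1](@sqr_sqrtr _ N%:R) ?ler0n//.
    by field; rewrite gt_eqF.
  by rewrite -[leRHS]invrK lef_pV2 ?posrE ?invr_gt0 ?divr_gt0// invf_div.
have -> : 2 / (ac * b) * pbelow x N = 2 * pbelow x N / (ac * b) by rewrite mulrAC.
rewrite powRNhalf ler_pdivlMr// mulrC ler_pdivrMr//.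
by move: h4; rewrite [leRHS]mulrDr => h4; lra.
Unshelve. all: by end_near. Qed.

End Core.

(** * Coefficients and scaling *)

Section Coefficients.
Variables (R : realType) (c : nat -> R).
Hypothesis cvg_kc : cvgn (series (fun k => k%:R * `|c k|)).
Hypothesis lim_neq0 : limn (series c) != 0.
Let S := limn (series c).

Lemma cvg_series_c : cvgn (series c).
Proof.
apply: contrapT => /dvgP h; move: lim_neq0; rewrite h.
by rewrite (_ : point = 0) ?eqxx.
Qed.

Definition Cn (j : nat) : R := (\sum_(0 <= k < j.+1) c k) / S.

Definition Dn : R := `|S|^-1 * limn (series (fun k => k%:R * `|c k|)).

Lemma sum_tail_le n m : (n <= m)%N ->
  \sum_(0 <= j < n) `|\sum_(0 <= k < j.+1) c k - \sum_(0 <= k < m.+1) c k| <=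
  limn (series (fun k => k%:R * `|c k|)).
Proof.
move=> nm; apply: le_trans (_ : series (fun k => k%:R * `|c k|) m.+1 <= _); last first.
  apply: nondecreasing_cvgn_le => //; apply/nondecreasing_seqP => k.
  by rewrite /series/= big_nat_recr//= lerDl mulr_ge0.
have tail j : (j < n)%N ->
    `|\sum_(0 <= k < j.+1) c k - \sum_(0 <= k < m.+1) c k| <=
    \sum_(0 <= k < m.+1) (j < k)%N%:R * `|c k|.
  move=> jn; have jm : (j.+1 <= m.+1)%N by rewrite ltnS ltnW// (leq_trans jn nm).
  rewrite [X in _ - X](big_cat_nat (n := j.+1))//= opprD addrA subrr add0r normrN.
  apply: le_trans (ler_norm_sum _ _ _) _.
  rewrite [leRHS](big_cat_nat (n := j.+1))//= -[leLHS]add0r; apply: lerD.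
    by apply: sumr_ge0 => k _; rewrite mulr_ge0.
  by apply: ler_sum_nat => k /andP[jk _]; rewrite jk mul1r.
have count k : \sum_(0 <= j < n) (j < k)%N%:R <= k%:R :> R.
  rewrite -natr_sum ler_nat; elim: (n) => [|i IHi]; first by rewrite big_geq.
  have [ik|ki] := ltnP i k; last by rewrite big_nat_recr//= ltnNge ki addn0.
  apply: leq_trans ik; rewrite -[leqRHS]subn0 -[leqRHS]muln1 -sum_nat_const_nat.
  by apply: leq_sum => j _; exact: leq_b1.
apply: le_trans (_ : \sum_(0 <= j < n) \sum_(0 <= k < m.+1) (j < k)%N%:R * `|c k| <= _).
  by apply: ler_sum_nat => j /andP[_]; exact: tail.
rewrite exchange_big/= /series/=; apply: ler_sum => k _.
by rewrite -mulr_suml ler_wpM2r.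
Qed.

Lemma sum_norm_Cn n : \sum_(0 <= j < n) `|Cn j - 1| <= Dn.
Proof.
have S0 : 0 < `|S|^-1 by rewrite invr_gt0 normr_gt0.
have -> : \sum_(0 <= j < n) `|Cn j - 1| =
    `|S|^-1 * \sum_(0 <= j < n) `|\sum_(0 <= k < j.+1) c k - S|.
  rewrite mulr_sumr; apply: eq_bigr => j _; rewrite -normfV -normrM; congr `|_|.
  by rewrite /Cn; field.
rewrite /Dn ler_pM2l//.
pose u m : R := \sum_(0 <= j < n) `|\sum_(0 <= k < j.+1) c k - series c m|.
have cu : u @ \oo --> \sum_(0 <= j < n) `|\sum_(0 <= k < j.+1) c k - S|.
  apply: cvg_big => [|j _]; first exact: add_continuous.
  apply: cvg_norm; apply: cvgB; first exact: cvg_cst.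
  exact: cvg_series_c.
apply: (cvgr_to_le cu); near=> m; have nm : (n < m)%N by near: m; exact: nbhs_infty_gt.
by rewrite -(prednK (leq_ltn_trans (leq0n n) nm)); apply: sum_tail_le; rewrite -ltnS prednK// (leq_ltn_trans _ nm).
Unshelve. all: by end_near. Qed.

End Coefficients.

Lemma pos_mass d (T : measurableType d) (R : realType) (P : probability T R)
    (X : T -> R) : measurable_fun setT X -> P.-integrable setT (EFin \o X) ->
  \int[P]_t X t = 0 -> (P [set t | X t = 0%R] < 1)%E ->
  exists2 a : R, 0 < a & (0 < P (X @^-1` [set y | a <= y]%R))%E.
Proof.
move=> mX iX X0; apply: contraPP => /forall2NP h.
have mA b : measurable (X @^-1` [set y | b <= y]%R).
  by apply: measurable_preimage => //; exact: measurable_ge.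
have null b : 0 < b -> P (X @^-1` [set y | b <= y]%R) = 0%E.
  move=> b0; have [//|] := h b; move=> /negP; rewrite -leNgt => hb.
  by apply/eqP; rewrite eq_le hb measure_ge0.
have neg : {ae P, forall t, X t <= 0}.
  apply: (@negligibleS _ _ _ _ (\bigcup_n X @^-1` [set y | n.+1%:R^-1 <= y]%R)).
    move=> t /= /negP; rewrite -ltNge => Xt.
    exists (Num.truncn (X t)^-1) => //=; rewrite invf_ple ?posrE//.
    by apply/ltW; rewrite truncnS_gt.
  by apply: negligible_bigcup => n; apply/negligibleP => //; exact: null.
have iaX : P.-integrable setT (EFin \o (fun t => `|X t|)) by exact: (integrable_abse iX).
have int0 : \int[P]_t `|X t| = 0.
  have : \int[P]_t (`|X t| + X t) = 0.
    rewrite /Rintegral (@ae_eq_integral _ _ _ P setT (cst 0%E))//; first by rewrite integral0.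
      by have /integrableP[] := integrableD_R iaX iX.
    apply: filterS neg => t /= Xt _; congr EFin.
    by rewrite ler0_norm// addNr.
  by rewrite RintegralD// X0 addr0.
have ae0 : ae_eq P setT (EFin \o X) (cst 0%E).
  apply/ae_eq_integral_abs => //; first exact: measurableT_comp.
  have fin := integrable_fin_num measurableT iaX.
  by move: int0; rewrite /Rintegral => /eqP; rewrite -eqe fineK// => /eqP.
have m0 : measurable [set t | X t = 0].
  by have := measurable_preimage mX (measurable_set1 0).
apply/negP; rewrite -leNgt.
have : P (~` [set t | X t = 0]) = 0%E.
  apply/negligibleP; first exact: measurableC.
  apply: negligibleS ae0 => t /= hX hh; apply: hX.
  by have [] := hh Logic.I.
by rewrite probability_setC// => /eqP; rewrite sube_eq ?add0e// => /eqP <-.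
Qed.

Lemma Xsum_conv d (T : measurableType d) (R : realType) (c : nat -> R) (Y : nat -> T -> R) (S : R)
    n N t : S != 0 -> (n <= N)%N ->
  Xsum c Y n t = conv (fun j => (\sum_(0 <= k < j.+1) c k) / S)
    (ypath (fun k t => S * Y k t) t N) n.
Proof.
move=> S0; elim: n => [|n IH] nN; first by rewrite /Xsum /conv !big_geq.
rewrite /Xsum big_nat_recr//= -/(Xsum c Y n t) IH ?(ltnW nN)//.
have yp i : (i < N)%N -> (ypath (fun k t => S * Y k t) t N)`_i = S * Y i.+1 t.
  by move=> iN; rewrite (nth_map 0%N) ?size_iota// nth_iota// add1n.
rewrite /conv /Xtilde big_add1/= [in RHS]big_nat_recr//= big_nat_recr//= addrA -big_split/=.
congr (_ + _); last by rewrite yp// !subnn big_nat1; field.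
apply: eq_big_nat => i /andP[_ hi]; rewrite yp ?(ltn_trans hi)//.
have [k ->] : exists k, n = (i + k).+1 by exists (n - i.+1)%N; rewrite -addSn subnKC.
rewrite subSS /= -addnS !addKn [in RHS]big_nat_recr//=.
by field.
Qed.

Section Scaling.
Context d (T : measurableType d) (R : realType) (P : probability T R).
Variables (Y : nat -> T -> R) (S : R).
Hypothesis mY : forall n, (0 < n)%N -> measurable_fun setT (Y n).
Local Notation Z := (fun k t => S * Y k t).

Lemma measurable_scale n : (0 < n)%N -> measurable_fun setT (Z n).
Proof. by move=> n0; apply: measurable_funM => //; exact: mY. Qed.

Let mS (B : set R) : measurable B -> measurable ((fun y => S * y) @^-1` B).
Proof.
move=> mB; rewrite -[X in measurable X]setTI.
by apply: (measurable_funM (measurable_cst S) (@measurable_id _ _ _)).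
Qed.

Lemma iid_indep_scale : iid_indep P Y -> iid_indep P Z.
Proof.
move=> h s B us s0 mB.
exact: (h s (fun i => (fun y => S * y) @^-1` B i) us s0 (fun i => mS (mB i))).
Qed.

Lemma ident_distr_scale : ident_distr P Y -> ident_distr P Z.
Proof. by move=> h n B n0 mB; exact: (h n _ n0 (mS mB)). Qed.

End Scaling.

Lemma integrable_ge0 d (T : measurableType d) (R : realType) (P : probability T R)
    (f : T -> R) : measurable_fun setT f -> (forall t, 0 <= f t) ->
  (\int[P]_t (f t)%:E < +oo)%E -> P.-integrable setT (EFin \o f).
Proof.
move=> mf f0 fi; apply/integrableP; split; first exact: measurableT_comp.
by under eq_integral do rewrite /= ger0_norm//.
Qed.

Lemma asymptotic_exponent (R : realType) (p : nat -> R) (b : R) :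
  (forall ep, 0 < ep -> \forall N \near \oo,
     N%:R `^ (- 2^-1) * ln N%:R `^ (- b - ep) <= p N) ->
  exists eps : nat -> R, eps @ \oo --> (0 : R) /\
    precsim (fun N => N%:R `^ (- 2^-1) * ln N%:R `^ (- b + eps N)) p.
Proof.
move=> h; pose q N := (ln (p N) + 2^-1 * ln N%:R) / ln (ln N%:R) + b.
have log_lower ep : 0 < ep -> \forall N \near \oo,
    [/\ 0 < N%:R :> R, 1 <= ln N%:R :> R, 0 < ln (ln N%:R) :> R, 0 < p N & - ep <= q N].
  move=> ep0; near=> N.
  have N0 : 0 < N%:R :> R by near: N; exact: nbhs_infty_gtr.
  have l1 : 1 <= ln N%:R :> R by near: N; exact: ln_ge1_near.
  have l0 : 0 < ln N%:R :> R by lra.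
  have ll1 : 1 <= ln (ln N%:R) :> R.
    by near: N; exact: (near_infty_natr (near_pinfty_ln (near_pinfty_ln (pinfty_ge 1)))).
  have ll0 : 0 < ln (ln N%:R) :> R by lra.
  have hN : N%:R `^ (- 2^-1) * ln N%:R `^ (- b - ep) <= p N by near: N; exact: h.
  have w0 : 0 < N%:R `^ (- 2^-1) * ln N%:R `^ (- b - ep) by rewrite mulr_gt0 ?powR_gt0.
  have p0 : 0 < p N by exact: lt_le_trans hN.
  split=> //; move: hN; rewrite -ler_ln ?posrE// lnM ?posrE ?powR_gt0// !ln_powR => hN.
  rewrite /q -lerBlDr ler_pdivlMr//; lra.
exists (fun N => Num.min 0 (q N)); split.
  apply/cvgrPdist_le => ep ep0; near=> N.
  have [_ _ _ _ hq] : [/\ 0 < N%:R :> R, 1 <= ln N%:R :> R, 0 < ln (ln N%:R) :> R,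
    0 < p N & - ep <= q N] by near: N; exact: log_lower.
  rewrite sub0r normrN ler_norml ge_min le_min hq andbT oppr_le0 (ltW ep0)//.
exists 1; near=> N.
have [N0 l1 ll0 p0 _] : [/\ 0 < N%:R :> R, 1 <= ln N%:R :> R, 0 < ln (ln N%:R) :> R,
  0 < p N & - 1 <= q N] by near: N; exact: log_lower.
have l0 : 0 < ln N%:R :> R by lra.
rewrite mul1r -ler_ln ?posrE ?mulr_gt0 ?powR_gt0// lnM ?posrE ?powR_gt0// !ln_powR.
have : Num.min 0 (q N) <= q N by rewrite ge_min lexx orbT.
move: (Num.min 0 (q N)) => e; rewrite /q -lerBlDr ler_pdivlMr//; lra.
Unshelve. all: by end_near. Qed.

Theorem mainTheorem16 (d : measure_display) (T : measurableType d)
  (R : realType) (P : probability T R) (Y : nat -> T -> R) (c : nat -> R) :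
  (forall n, (0 < n)%N -> measurable_fun setT (Y n)) ->
  iid_indep P Y ->
  ident_distr P Y ->
  nondegenerate_rv P (Y 1%N) ->
  integrable P setT (EFin \o Y 1%N) ->
  (\int[P]_t (Y 1%N t)%:E = 0)%E ->
  cvgn (series (fun k => k%:R * `|c k|)) ->
  limn (series c) != 0 ->
  (* (1) bounded case *)
  ((exists M : R, {ae P, forall t, `|Y 1%N t| <= M}) ->
     exists x0 : R, 0 <= x0 /\
       forall x : R, x0 <= x ->
         asymp (prob_sup_le P c Y x) (fun N => N%:R `^ (- 2^-1)))
  /\
  (* (2) upper bound under an exponential moment *)
  (forall alpha : R, 0 < alpha ->
     (\int[P]_t (expR (`|Y 1%N t| `^ alpha))%:E < +oo)%E ->
     forall x : R, 0 <= x ->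
       precsim (prob_sup_le P c Y x)
         (fun N => N%:R `^ (- 2^-1) * ln N%:R `^ alpha^-1))
  /\
  (* (3) lower bound under an exponential moment and nonnegative partial sums *)
  (forall alpha : R, 0 < alpha ->
     (\int[P]_t (expR (`|Y 1%N t| `^ alpha))%:E < +oo)%E ->
     (forall n : nat, 0 <= \sum_(0 <= k < n.+1) c k) ->
     forall x : R, 0 <= x ->
       exists eps : nat -> R, eps @ \oo --> 0 /\
         precsim (fun N => N%:R `^ (- 2^-1) * ln N%:R `^ (- alpha^-1 + eps N))
                 (prob_sup_le P c Y x)).
Proof.
move=> mY indY idY ndY iY mean0 cvg_kc S0.
set S := limn (series c) in S0; pose Z k t := S * Y k t.
have mZ := measurable_scale S mY : forall n, (0 < n)%N -> measurable_fun setT (Z n).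
have indZ : iid_indep P Z by exact: iid_indep_scale.
have idZ : ident_distr P Z by exact: ident_distr_scale.
have iZ : P.-integrable setT (EFin \o Z 1%N) by exact: (integrableZl_R S iY).
have mean0Z : \int[P]_t Z 1%N t = 0.
  by rewrite RintegralZl// /Rintegral mean0 mulr0.
have [a a0 posZ] : exists2 a : R, 0 < a & (0 < P (Z 1%N @^-1` [set y | a <= y]%R))%E.
  apply: pos_mass => //; first exact: mZ.
  rewrite (_ : [set t | Z 1%N t = 0] = [set t | Y 1%N t = 0]); first exact: ndY.
  apply/seteqP; split => t /=; last by rewrite /Z => ->; rewrite mulr0.
  by move=> /eqP; rewrite mulf_eq0 (negbTE S0) => /eqP.
pose C := Cn c; pose D := Dn c.
have CD n : \sum_(0 <= j < n) `|C j - 1| <= D by exact: sum_norm_Cn.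
have pE x : prob_sup_le P c Y x = pbelow P Z C x.
  apply/funext => N; rewrite /prob_sup_le /pbelow; congr (fine (P _)).
  apply/seteqP; split => t /= h.
    apply/belowP => n; rewrite size_map size_iota => nN.
    by have := h n.+1 nN; rewrite (Xsum_conv _ _ _ S0 nN).
  move=> [//|n] /= nN; rewrite (Xsum_conv _ _ _ S0 nN).
  by move: h => /belowP; apply; rewrite size_map size_iota.
have expZ al : 0 < al -> (\int[P]_t (expR (`|Y 1%N t| `^ al))%:E < +oo)%E ->
    0 < (`|S| `^ al)^-1 /\ P.-integrable setT
      (EFin \o (fun t => expR ((`|S| `^ al)^-1 * `|Z 1%N t| `^ al))).
  move=> al0 fi; have s0 : 0 < `|S| `^ al by rewrite powR_gt0// normr_gt0.
  split; first by rewrite invr_gt0.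
  rewrite (_ : (fun t => _) = (fun t => expR (`|Y 1%N t| `^ al))); last first.
    by apply/funext => t; rewrite normrM powRM// mulrA mulVf ?mul1r// gt_eqF.
  apply: integrable_ge0 => //.
  apply: measurableT_comp => //; apply: (measurableT_comp (@measurable_powR _ al)).
  by apply: measurableT_comp => //; exact: mY.
split; [|split].
- move=> [M aeM]; have aeZ : {ae P, forall t, `|Z 1%N t| <= `|S| * M}.
    by apply: filterS aeM => t h; rewrite normrM ler_wpM2l.
  have eZ : P.-integrable setT (EFin \o (fun t => expR (1 * `|Z 1%N t| `^ 1))).
    have mE : measurable_fun setT (fun t => expR (1 * `|Z 1%N t| `^ 1)).
      apply: measurableT_comp => //; apply: measurable_funM => //.
      apply: (measurableT_comp (@measurable_powR _ 1)).
      by apply: measurableT_comp => //; exact: mZ.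
    apply: integrable_ge0 => //.
    apply: (@le_lt_trans _ _ (\int[P]_t (expR (`|S| * M))%:E)%E).
      apply: ae_ge0_le_integral => //.
        exact: measurableT_comp.
      apply: filterS aeZ => t h _.
      by rewrite lee_fin ler_expR mul1r powRr1.
    rewrite integral_cst// -ge0_fin_numE ?mule_ge0 ?lee_fin ?expR_ge0//.
    by rewrite fin_numM// fin_num_measure.
  have [x0 [x00 h]] := core_bounded mZ indZ idZ iZ mean0Z ltr01 ltr01 a0 eZ posZ CD aeZ.
  by exists x0; split=> // x; rewrite pE; exact: h.
- move=> al al0 fi x x0; have [l0 eZ] := expZ al al0 fi; rewrite pE.
  exact: (core_upper mZ indZ idZ iZ mean0Z l0 al0 a0 eZ posZ CD x0).
- move=> al al0 fi c0 x x0; have [l0 eZ] := expZ al al0 fi; rewrite pE.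
  have Sge0 : 0 <= S.
    apply: limr_ge; first exact: cvg_series_c.
    near=> n; have n0 : (0 < n)%N by near: n; exists 1%N.
    by rewrite -(prednK n0); exact: c0.
  have C0 j : 0 <= C j by rewrite /C /Cn divr_ge0.
  apply: asymptotic_exponent => ep ep0.
  exact: (core_lower mZ indZ idZ iZ mean0Z l0 al0 a0 eZ posZ CD C0 x0 ep0).
Unshelve. all: by end_near. Qed.
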